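(* Let $I=[a,b]$, $J=[c,d]\subset\mathbb{R}$, let $\mu=\mu_1\times\mu_2$, $\nu=\nu_1\times\nu_2$, $w=w_1\times w_2$ be product weights on $I\times J$ with $\mu,\nu\in L^1(I\times J)$, let $1\le p_1,p_2,s_1<\infty$, and let $\Phi$ be a Young function. Suppose that $\Phi$ is invertible on $[0,\infty)$. If there exist constants $C_1,C_2>0$ such that $$\left\|f-\frac{1}{\nu(I\times J)}\int_{I\times J}f(y_1,y_2)\,d\nu_1(y_1)\,d\nu_2(y_2)\right\|_{L^\Phi_\mu(I\times J)}\le C_1\left\|\frac{\partial f}{\partial x_1}\right\|_{L^{(p_1,\Phi)}_{w_1\times\mu_2}(I\times J)}+C_2\cdot\frac{2\left[\Phi^{-1}\left(\frac{1}{\mu_1(I)}\right)\right]^{-1}}{\nu_1(I)^{1/s_1}}\left\|\frac{\partial f}{\partial x_2}\right\|_{L^{(\widehat{s_1,p_2})}_{\nu_1\times w_2}(I\times J)}$$ for all Lipschitz continuous functions $f\colon I\times J\to\mathbb{R}$, then $\tilde K_{p_i,\Phi}(\mu_i,\nu_i,w_i)<\infty$ for $i=1,2$.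
   Context: Weights are nonnegative measurable functions, identified with the measures having them as densities with respect to Lebesgue measure: $d\mu_1=\mu_1(x)\,dx$, $\mu_1[s,t]=\int_s^t\mu_1(x)\,dx$, and so on. A product weight $\mu=\mu_1\times\mu_2$ on $I\times J$ has $\mu_1$ a weight on $I$ and $\mu_2$ a weight on $J$. A Young function is a convex, even function $\Phi\colon\mathbb{R}\to[0,\infty)$ with $\Phi(0)=0$ and $\lim_{t\to\infty}\Phi(t)=+\infty$. $\Phi^{-1}$ is the inverse of $\Phi$ on $[0,\infty)$. Gauge norm: for measurable $f\colon I\times J\to\mathbb{R}$, $\|f\|_{L^\Phi_\mu(I\times J)}:=\inf\{k>0:\int_{I\times J}\Phi(f/k)\,d\mu\le1\}$; the one-dimensional gauge norms $\|\cdot\|_{L^\Phi_{\mu_1}(I)}$, $\|\cdot\|_{L^\Phi_{\mu_2}(J)}$ are defined in the same way on $I$, $J$ with the measures $\mu_1$, $\mu_2$. Iterated norms: for measurable $F\colon I\times J\to\mathbb{R}$, $$\|F\|_{L^{(p_1,\Phi)}_{w_1\times\mu_2}(I\times J)}:=\Big\|\,\|F\|_{L^{p_1}_{w_1}(I)}\Big\|_{L^\Phi_{\mu_2}(J)},\qquad \|F\|_{L^{(\widehat{s_1,p_2})}_{\nu_1\times w_2}(I\times J)}:=\Big\|\,\|F\|_{L^{p_2}_{w_2}(J)}\Big\|_{L^{s_1}_{\nu_1}(I)},$$ where the inner norm is taken in one variable ($x_1\in I$ in the first case, $x_2\in J$ in the second) with the other variable fixed, and the outer norm is taken of the resulting function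 of the other variable. The constants $\tilde K_{p_1,\Phi}(\mu_1,\nu_1,w_1)$: for $p_1=1$, $$\tilde K_{1,\Phi}(\mu_1,\nu_1,w_1)=\frac{1}{\nu_1(I)}\sup_{a<x<b}\left\{\frac{1}{w_1(x)}\left\|\nu_1[a,x]\chi_{[x,b]}-\nu_1[x,b]\chi_{[a,x]}\right\|_{L^\Phi_{\mu_1}(I)}\right\},$$ and for $p_1>1$, with $p_1'$ the Hölder conjugate of $p_1$, $$\tilde K_{p_1,\Phi}(\mu_1,\nu_1,w_1)=\frac{1}{\nu_1(I)}\Biggl(\sup_{a<x<b}\Bigl\{\Bigl[\Phi^{-1}\Bigl(\tfrac{1}{\mu_1[x,b]}\Bigr)\Bigr]^{-1}\Bigl(\int_a^x\nu_1[a,t]^{p_1'}w_1(t)^{1-p_1'}\,dt\Bigr)^{1/p_1'}\Bigr\}+\sup_{a<x<b}\Bigl\{\Bigl[\Phi^{-1}\Bigl(\tfrac{1}{\mu_1[a,x]}\Bigr)\Bigr]^{-1}\Bigl(\int_x^b\nu_1[t,b]^{p_1'}w_1(t)^{1-p_1'}\,dt\Bigr)^{1/p_1'}\Bigr\}\Biggr).$$ The constant $\tilde K_{p_2,\Phi}(\mu_2,\nu_2,w_2)$ is defined by the same formulas with $I=[a,b]$ replaced by $J=[c,d]$ and $(p_1,\mu_1,\nu_1,w_1)$ replaced by $(p_2,\mu_2,\nu_2,w_2)$.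
   Formalization: For p_i = 1 the supremum over x defining the constant is an essential supremum, since the pointwise one is infinite if w_i is set to 0 at a point; and μ and ν are assumed not to be the zero measure on I×J, without which the claim fails or divides by zero. *)

(* Defs.v *)
From HB Require Import structures.
From mathcomp Require Import all_boot all_order all_algebra.
From mathcomp Require Import all_classical all_reals all_analysis ess_sup_inf.
Set Implicit Arguments.
Unset Strict Implicit.
Unset Printing Implicit Defensive.
Import Order.TTheory GRing.Theory Num.Theory.
Import numFieldNormedType.Exports.

Local Open Scope classical_set_scope.
Local Open Scope ring_scope.
Local Open Scope ereal_scope.

(* Everything is set in MathComp-Analysis, over R : realType. Formulas that may
   degenerate are evaluated in \bar R, where 0^-1 = +oo, +oo^-1 = 0 and
   0 * +oo = 0. *)

Section young.
Context {R : realType}.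

Record young_function (Phi : R -> R) : Prop := {
  young_ge0 : forall t, (0 <= Phi t)%R;
  young_convex : convex_function (setT : set R^o) (Phi : R^o -> R^o);
  young_even : forall t, Phi (- t)%R = Phi t;
  young0 : Phi 0%R = 0%R;
  young_cvgy : Phi t @[t --> +oo%R] --> +oo%R
}.

Definition young_invertible (Phi : R -> R) : Prop :=
  set_bij `[0%R, +oo[ `[0%R, +oo[ Phi.

(* Phi is even and tends to +oo, hence takes the value +oo at both infinities. *)
Definition young_ext (Phi : R -> R) (x : \bar R) : \bar R :=
  if x is r%:E then (Phi r)%:E else +oo.

(* Phi^-1 (+oo) = +oo, so that [Phi^-1 (1 / 0)]^-1 = 0. *)
Definition young_inv (Phi : R -> R) : \bar R -> \bar R :=
  er_map ('pinv_(fun=> 0%R) `[0%R, +oo[ Phi).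

End young.

Section weighted.
Context {d : measure_display} {T : measurableType d} {R : realType}.
Variables (m : {measure set T -> \bar R}) (D : set T).

Definition weight (w : T -> R) : Prop :=
  measurable_fun D w /\ forall x, D x -> (0 <= w x)%R.

(* The integral over D against the measure of density w with respect to m. *)
Definition wintegral (w : T -> R) (F : T -> \bar R) : \bar R :=
  \int[m]_(x in D) (F x * (w x)%:E).

Definition wmass (w : T -> R) : \bar R := \int[m]_(x in D) (w x)%:E.

Definition waverage (w : T -> R) (f : T -> R) : R :=
  (fine (wintegral w (EFin \o f)) / fine (wmass w))%R.

Definition wLp_norm (p : R) (w : T -> R) (F : T -> \bar R) : \bar R :=
  (wintegral w (fun x => `|F x| `^ p)) `^ p^-1.

Definition gauge_norm (Phi : R -> R) (w : T -> R) (F : T -> \bar R) : \bar R :=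
  ereal_inf [set k%:E | k in [set k : R | (0 < k)%R /\
    wintegral w (fun x => young_ext Phi (F x / k%:E)) <= 1]].

End weighted.

Section plane.
Context {R : realType}.

Definition leb1 : {measure set (measurableTypeR R) -> \bar R} :=
  @lebesgue_measure R.

Definition leb2 :
    {measure set (measurableTypeR R * measurableTypeR R) -> \bar R} :=
  @lebesgue_measure R \x @lebesgue_measure R.

Definition prod_weight (w1 w2 : R -> R) (x : R * R) : R := (w1 x.1 * w2 x.2)%R.

(* A Lipschitz function on a rectangle has these derivatives at almost every
   point of every line; elsewhere they are junk, which no integral sees. *)
Definition partial1 (f : R * R -> R) (x : R * R) : R :=
  derive1 (fun t : R => f (t, x.2) : R^o) x.1.
Definition partial2 (f : R * R -> R) (x : R * R) : R :=
  derive1 (fun t : R => f (x.1, t) : R^o) x.2.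

(* Inner L^p norm in the first variable, outer gauge norm in the second. *)
Definition norm_Lp_gauge (I J : set R) (p : R) (Phi w1 mu2 : R -> R)
    (F : R * R -> R) : \bar R :=
  gauge_norm leb1 J Phi mu2
    (fun x2 => wLp_norm leb1 I p w1 (fun x1 => (F (x1, x2))%:E)).

(* The hatted space: inner L^p norm in the second variable, outer L^s norm in
   the first. *)
Definition norm_hat (I J : set R) (s p : R) (nu1 w2 : R -> R)
    (F : R * R -> R) : \bar R :=
  wLp_norm leb1 I s nu1
    (fun x1 => wLp_norm leb1 J p w2 (fun x2 => (F (x1, x2))%:E)).

Definition imass (w : R -> R) (s t : R) : \bar R := wmass leb1 `[s, t] w.

(* The supremum over a < x < b is essential: w only matters as a density, and
   a pointwise supremum of 1 / w would depend on its values on a null set. The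
   function is nonnegative, so its extension by 0 outside ]a, b[ is harmless. *)
Definition Ktilde1 (a b : R) (Phi mu nu w : R -> R) : \bar R :=
  (imass nu a b)^-1 *
  ess_sup leb1 ((fun x =>
    (w x)%:E^-1 *
    gauge_norm leb1 `[a, b] Phi mu
      (fun y => imass nu a x * (\1_(`[x, b] : set R) y)%:E
              - imass nu x b * (\1_(`[a, x] : set R) y)%:E)) \_ `]a, b[).

(* w^(1 - q) is written (w^-1)^(q - 1) because it must be +oo where w = 0,
   whereas 0 `^ (1 - q) is 0 in the library. *)
Definition Ktildep (p a b : R) (Phi mu nu w : R -> R) : \bar R :=
  let q := (p / (p - 1))%R in
  (imass nu a b)^-1 *
  (ereal_sup [set (young_inv Phi (imass mu x b)^-1)^-1 *
      (\int[leb1]_(t in `[a, x])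
         (imass nu a t `^ q * (w t)%:E^-1 `^ (q - 1))) `^ q^-1
    | x in `]a, b[] +
   ereal_sup [set (young_inv Phi (imass mu a x)^-1)^-1 *
      (\int[leb1]_(t in `[x, b])
         (imass nu t b `^ q * (w t)%:E^-1 `^ (q - 1))) `^ q^-1
    | x in `]a, b[]).

Definition Ktilde (p a b : R) (Phi mu nu w : R -> R) : \bar R :=
  if p == 1%R then Ktilde1 a b Phi mu nu w else Ktildep p a b Phi mu nu w.

End plane.

(* Main.v *)
Require Import Defs.
From HB Require Import structures.
From mathcomp Require Import all_boot all_order all_algebra.
From mathcomp Require Import all_classical all_reals all_analysis ess_sup_inf.
From mathcomp Require Import measurable_realfun.
From mathcomp Require Import ring.
Import Order.TTheory GRing.Theory Num.Theory.
Import numFieldNormedType.Exports.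

Local Open Scope classical_set_scope.
Local Open Scope ring_scope.
Local Open Scope ereal_scope.

Set Implicit Arguments.
Unset Strict Implicit.
Unset Printing Implicit Defensive.

(** The inequality is tested on functions of one variable only. For
    [f z = g z.1] the second term on the right vanishes, the first one is a
    constant multiple of the one-dimensional norm of [g'] in [L^p_w], and the
    left-hand side controls the oscillation of [g] around its [nu]-average. For
    [f z = g z.2] the two terms exchange their roles. Both cases therefore give
    the same one-dimensional inequality, [oscillation_bound], through
    [oscillation_bound_fst] and [oscillation_bound_snd].

    Let now [g] be the primitive of a bounded function [h >= 0] supported in
    [[a, x]]. It is constant on [[x, b]], and by Fubini it exceeds its average
    there by [nu(I)^-1 * \int_a^x nu[a, t] h(t) dt]. Since the gauge norm of the
    indicator of a set of mass [W] is [1 / Phi^-1 (1 / W)], one obtains the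
    estimate [hardy_left],
    [[1 / Phi^-1 (1 / mu[x, b]) * \int_a^x nu[a, t] h(t) dt
        <= C * nu(I) * (\int_a^x h^p w)^(1/p),]]
    and, with [h] supported in [[x, b]], its mirror image [hardy_right].

    Taking the supremum over [h] finishes the proof. If [p > 1], almost extremal
    functions of Hoelder's inequality turn the integral on the left into the
    [L^q] norm that defines the constant ([weak_boundp]). If [p = 1], indicators
    give a pointwise bound for almost every [t < x] ([weak_bound1_ae]); it holds
    almost everywhere for all rational [x] at once, so [x] may be sent to [t].
    The two halves of the function whose gauge norm defines the constant are then
    put together by convexity ([gauge_norm_two_steps]). *)

(** * Young functions and the gauge norm of an indicator *)

Section young_functions.
Context {R : realType}.
Variable Phi : R -> R.
Hypothesis hPhi : young_function Phi.

Lemma young_conv (s t u : R) : (0 <= s <= 1)%R ->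
  (Phi (s * t + (1 - s) * u) <= s * Phi t + (1 - s) * Phi u)%R.
Proof.
move=> /andP[s0 s1].
exact: (young_convex hPhi (Itv01 s0 s1) (mem_set I) (mem_set I) (x := t) (y := u)).
Qed.

Lemma young_contract (s t : R) : (0 <= s <= 1)%R ->
  (Phi (s * t) <= s * Phi t)%R.
Proof.
by move=> /(young_conv t 0%R); rewrite (young0 hPhi) !mulr0 !addr0.
Qed.

Lemma young_homo (s t : R) : (0 <= s)%R -> (s <= t)%R -> (Phi s <= Phi t)%R.
Proof.
move=> s0 st; have [t0|t0] := eqVneq t 0%R.
  by have -> : s = t by apply/le_anti; rewrite st t0 s0.
have tgt0 : (0 < t)%R by rewrite lt_neqAle eq_sym t0 (le_trans s0).
have st1 : (0 <= s / t <= 1)%R.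
  by rewrite divr_ge0 ?ler_pdivrMr ?mul1r// (le_trans s0).
rewrite -{1}(divfK t0 s); apply: (le_trans (young_contract _ st1)).
by rewrite ler_piMl ?(young_ge0 hPhi)//; case/andP: st1.
Qed.

Lemma young_normr (t : R) : Phi `|t|%R = Phi t.
Proof. by case: (ger0P t) => // _; rewrite (young_even hPhi). Qed.

Hypothesis Phi_inv : young_invertible Phi.

Lemma young_inv_fin (r : R) : (0 < r)%R ->
  exists2 t : R, (0 < t)%R & Phi t = r /\ young_inv Phi r%:E = t%:E.
Proof.
move=> r0; set t := 'pinv_(fun=> 0%R) `[0%R, +oo[ Phi r.
have rB : `[0%R, +oo[%classic r by rewrite /= in_itv/= (ltW r0).
have Phit : Phi t = r.
  by case: Phi_inv => _ _ sj; exact: (surjpK (fun=> 0%R) sj (mem_set rB)).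
have t0 : (0 <= t)%R.
  have [+ _ _] := bijpinv_bij (fun=> 0%R) Phi_inv.
  by move=> /(_ _ rB); rewrite /= in_itv/= andbT.
exists t => //; rewrite lt_neqAle t0 andbT; apply/eqP => t0'.
by move: r0; rewrite -Phit -t0' (young0 hPhi) ltxx.
Qed.

(** The number [1 / Phi^-1 (1 / W)] is the gauge norm of the indicator of a set
    of mass [W]. This lemma and the next two express it as an admissibility test
    for the scale [k] of a function equal to [m] on such a set. *)
Lemma gauge_coef_fin (W : \bar R) : 0 <= W -> W < +oo ->
  exists2 g : R, (0 <= g)%R & (young_inv Phi W^-1)^-1 = g%:E.
Proof.
move: W => [W| |]// W0 _; rewrite lee_fin in W0.
have [->|Wn0] := eqVneq W 0%R.
  by exists 0%R => //; rewrite inve0 /= invey.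
have W'0 : (0 < W^-1)%R by rewrite invr_gt0 lt_neqAle eq_sym Wn0.
have [t t0 [_ tE]] := young_inv_fin W'0.
by exists (t^-1)%R; rewrite ?invr_ge0 ?(ltW t0)// inver (negbTE Wn0) tE inver gt_eqF.
Qed.

Lemma gauge_coef_le (W : \bar R) (m k : R) : 0 <= W -> W < +oo ->
  (0 <= m)%R -> (0 < k)%R -> (Phi (m / k))%:E * W <= 1 ->
  (young_inv Phi W^-1)^-1 * m%:E <= k%:E.
Proof.
move: W => [W| |]// W0 _ m0 k0; rewrite lee_fin in W0.
have [->|Wn0] := eqVneq W 0%R.
  by move=> _; rewrite inve0 /= invey mul0e lee_fin ltW.
have Wgt0 : (0 < W)%R by rewrite lt_neqAle eq_sym Wn0.
have [t t0 [Phit tE]] := young_inv_fin (etrans (invr_gt0 W) Wgt0).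
rewrite inver (negbTE Wn0) tE inver gt_eqF// -EFinM !lee_fin.
rewrite -ler_pdivlMr// div1r -Phit => le1.
rewrite mulrC ler_pdivrMr// -ler_pdivrMl// mulrC leNgt; apply/negP => lt1.
have eqPhi : Phi (m / k) = Phi t.
  by apply/le_anti; rewrite le1 young_homo// ltW.
have [_ inj _] := Phi_inv.
suff eqt : (m / k)%R = t by rewrite eqt ltxx in lt1.
by apply: inj => //; rewrite inE/= in_itv/= ?(ltW t0)// divr_ge0// ltW.
Qed.

Lemma gauge_coef_admissible (W : \bar R) (m k : R) : 0 <= W -> W < +oo ->
  (0 <= m)%R -> (0 < k)%R -> (young_inv Phi W^-1)^-1 * m%:E <= k%:E ->
  (Phi (m / k))%:E * W <= 1.
Proof.
move: W => [W| |]// W0 _ m0 k0; rewrite lee_fin in W0.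
have [->|Wn0] := eqVneq W 0%R; first by rewrite mule0.
have Wgt0 : (0 < W)%R by rewrite lt_neqAle eq_sym Wn0.
have [t t0 [Phit tE]] := young_inv_fin (etrans (invr_gt0 W) Wgt0).
rewrite inver (negbTE Wn0) tE inver gt_eqF// -EFinM lee_fin => le1.
rewrite -EFinM lee_fin -ler_pdivlMr// div1r -Phit.
rewrite young_homo ?divr_ge0 ?(ltW k0)//.
by rewrite ler_pdivrMr// -ler_pdivrMl.
Qed.

Lemma gauge_scale (W : \bar R) : 0 < W < +oo ->
  exists2 k : R, (0 < k)%R & (Phi (1 / k))%:E * W <= 1.
Proof.
case: W => [r| |]//; rewrite ?ltxx ?andbF// => /andP[r0 _].
have [|t t0 [Phit _]] := @young_inv_fin (r^-1)%R; first by rewrite invr_gt0.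
exists (t^-1)%R; rewrite ?invr_gt0//.
by rewrite div1r invrK Phit -EFinM mulVf// gt_eqF.
Qed.

End young_functions.

(** * Monotonicity of the integral without measurability *)

Section integrals_without_measurability.
Context {d : measure_display} {T : measurableType d} {R : realType}.
Variables (m : {measure set T -> \bar R}).
Implicit Types (D A : set T) (f g : T -> \bar R) (w : T -> R).

(** The integral of a nonnegative function is a supremum over the simple
    functions below it, hence is monotone even where neither side is known to
    be measurable. This is what is needed for the derivatives and for the
    compositions with the Young function. *)
Lemma ge0_integral_homo D f g : (forall x, D x -> 0 <= f x) ->
  (forall x, D x -> f x <= g x) -> \int[m]_(x in D) f x <= \int[m]_(x in D) g x.
Proof.
move=> f0 fg.
have g0 x : D x -> 0 <= g x by move=> Dx; rewrite (le_trans (f0 _ Dx))// fg.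
rewrite !ge0_integralE//; apply: ereal_sup_le => _ [h hf <-].
exists h => // x; apply: (le_trans (hf x)); rewrite !patchE.
by case: ifP => // /set_mem /fg.
Qed.

Lemma ge0_integral_homo_sub D A f g : A `<=` D -> (forall x, A x -> 0 <= f x) ->
  (forall x, D x -> 0 <= g x) ->
  (forall x, A x -> f x <= g x) -> \int[m]_(x in A) f x <= \int[m]_(x in D) g x.
Proof.
move=> AD f0 g0 fg; rewrite integral_mkcond [leRHS]integral_mkcond.
apply: ge0_integral_homo => x _; rewrite !patchE.
  by case: ifPn => // /set_mem /f0.
case: ifPn => [/set_mem Ax|_]; first by rewrite (mem_set (AD _ Ax)) fg.
by case: ifPn => // /set_mem /g0.
Qed.

Lemma ge0_integral_homo_ae D f g : measurable D -> measurable_fun D g ->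
  (forall x, D x -> 0 <= f x) -> (forall x, D x -> 0 <= g x) ->
  {ae m, forall x, D x -> f x <= g x} ->
  \int[m]_(x in D) f x <= \int[m]_(x in D) g x.
Proof.
move=> mD mg f0 g0 [N [mN N0 subN]].
pose g' := fun x => if x \in N then +oo else g x.
have mN' : measurable_fun setT (fun x => x \in N).
  apply: (measurable_fun_bool true); rewrite setTI (_ : _ @^-1` _ = N)//.
  by apply/seteqP; split => x /= => [/set_mem|/mem_set].
have mg' : measurable_fun D g'.
  apply: measurable_fun_if => //; first exact: measurable_funTS.
  by apply: measurable_funS mg => // x [].
have -> : \int[m]_(x in D) g x = \int[m]_(x in D) g' x.
  apply: ge0_ae_eq_integral => //.
    by move=> x Dx; rewrite /g'; case: ifP => // _; exact: g0.
  exists N; split => // x /= xN; apply: contrapT => Nx; apply: xN => _.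
  by rewrite /g' memNset.
apply: ge0_integral_homo => // x Dx; rewrite /g'; case: ifPn => [_|]; first exact: leey.
rewrite notin_setE => Nx; apply: contrapT => fg; apply: Nx; apply: subN => /= H.
by apply: fg; exact: H.
Qed.

End integrals_without_measurability.

(** * Integrals of product weights *)

Section prod_weights.
Context {R : realType}.
Implicit Types (A B : set R) (u v : R -> R).

Lemma integral_prod_weight A B u v : measurable A -> measurable B ->
  measurable_fun A u -> measurable_fun B v ->
  (forall x, A x -> (0 <= u x)%R) -> (forall x, B x -> (0 <= v x)%R) ->
  \int[leb2]_(z in A `*` B) (u z.1 * v z.2)%:E =
  (\int[leb1]_(x in A) (u x)%:E) * (\int[leb1]_(y in B) (v y)%:E).
Proof.
move=> mA mB mu mv u0 v0; rewrite integral_mkcond.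
have -> : (fun z : R * R => (u z.1 * v z.2)%:E) \_ (A `*` B) =
    (fun z => ((u \_ A) z.1 * (v \_ B) z.2)%:E).
  apply/funext => -[x y]; rewrite !patchE/= in_setX/=.
  by case: (x \in A); case: (y \in B) => //=; rewrite ?mulr0 ?mul0r.
have mu' : measurable_fun setT (u \_ A) by apply/(measurable_restrictT _ _).1.
have mv' : measurable_fun setT (v \_ B) by apply/(measurable_restrictT _ _).1.
have u'0 x : (0 <= (u \_ A) x)%R.
  by rewrite patchE; case: ifP => // /set_mem /u0.
have v'0 x : (0 <= (v \_ B) x)%R.
  by rewrite patchE; case: ifP => // /set_mem /v0.
rewrite /leb2 fubini_tonelli1/=; last 2 first.
  apply/measurable_EFinP; apply: measurable_funM.
    exact: (measurableT_comp mu').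
  exact: (measurableT_comp mv').
  by move=> z; rewrite lee_fin mulr_ge0.
rewrite /fubini_F/=.
under eq_integral => x _.
  under eq_integral do rewrite EFinM.
  rewrite ge0_integralZl//; last 3 first.
    exact/measurable_EFinP.
    by move=> y _; rewrite lee_fin.
    by rewrite lee_fin.
  over.
rewrite ge0_integralZr//; last 3 first.
  exact/measurable_EFinP.
  by move=> x _; rewrite lee_fin.
  by apply: integral_ge0 => y _; rewrite lee_fin.
congr (_ * _); rewrite [RHS]integral_mkcond; apply: eq_integral => x _;
  by rewrite !patchE; case: ifP.
Qed.

Lemma wmass_prod_weight A B u v : measurable A -> measurable B ->
  measurable_fun A u -> measurable_fun B v ->
  (forall x, A x -> (0 <= u x)%R) -> (forall x, B x -> (0 <= v x)%R) ->
  wmass leb2 (A `*` B) (prod_weight u v) = wmass leb1 A u * wmass leb1 B v.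
Proof. by move=> *; exact: integral_prod_weight. Qed.

End prod_weights.

(** * Primitives of bounded functions *)

Section primitive.
Context {R : realType}.
Variables (a M : R) (h : R -> R).
Hypothesis mh : measurable_fun setT h.
Hypothesis h0 : forall x, (0 <= h x)%R.
Hypothesis hM : forall x, (h x <= M)%R.

Definition primitive (y : R) : R :=
  (\int[lebesgue_measure]_(t in `[a, y]) h t)%R.

Lemma integrable_bounded_itv (s t : R) :
  (@lebesgue_measure R).-integrable `[s, t] (EFin \o h).
Proof.
apply: measurable_bounded_integrable => //.
- rewrite /= (@lebesgue_measure_itv R `[s, t])/=.
  by case: ifP => // _; rewrite -EFinB ltry.
- exact: measurable_funTS.
- exists M; split; first exact: num_real.
  by move=> x Mx y _ /=; rewrite ger0_norm// (le_trans (hM y))// ltW.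
Qed.

Lemma EFin_primitive (y : R) :
  (primitive y)%:E = \int[leb1]_(t in `[a, y]) (h t)%:E.
Proof.
rewrite /primitive /Rintegral fineK//.
exact: (integrable_fin_num _ (integrable_bounded_itv a y)).
Qed.

Lemma primitive_ge0 (y : R) : (0 <= primitive y)%R.
Proof. by apply: Rintegral_ge0 => x _. Qed.

Lemma primitive_homo : {homo primitive : y z / (y <= z)%R}.
Proof.
move=> y z yz; rewrite -lee_fin !EFin_primitive.
apply: ge0_integral_homo_sub => // x /=.
- by rewrite !in_itv/= => /andP[-> /le_trans]; exact.
- by rewrite lee_fin.
- by rewrite lee_fin.
Qed.

Lemma measurable_primitive (D : set R) : measurable D ->
  measurable_fun D primitive.
Proof. by move=> mD; exact: nondecreasing_measurable primitive_homo. Qed.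

Lemma primitive_lip (y z : R) : (a <= y)%R -> (a <= z)%R ->
  (`|primitive y - primitive z| <= M * `|y - z|)%R.
Proof.
wlog yz : y z / (z <= y)%R.
  by move=> H ay az; have [/H|/ltW/H] := leP z y; [exact|rewrite distrC (distrC y); exact].
move=> ay az; rewrite ger0_norm ?subr_ge0 ?primitive_homo// (ger0_norm (x := (y - z)%R)) ?subr_ge0//.
rewrite /primitive Rintegral_itvB ?bnd_simp//; last first.
  exact: integrable_bounded_itv.
have -> : (M * (y - z))%R = (\int[lebesgue_measure]_(x in `]z, y]) (cst M x))%R.
  rewrite Rintegral_cst//= (@lebesgue_measure_itv R `]z, y])/= lte_fin.
  by move: yz; case: ltgtP => // -> _; rewrite subrr.
have sub : `]z, y] `<=` `[z, y] by move=> x /=; rewrite !in_itv/= => /andP[/ltW-> ->].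
apply: le_Rintegral => //.
- by apply: integrableS (integrable_bounded_itv z y).
- apply: measurable_bounded_integrable => //.
    rewrite /= (@lebesgue_measure_itv R `]z, y])/=.
    by case: ifP => // _; rewrite -EFinB ltry.
  by exists M; split; [exact: num_real|move=> x Mx t _ /=; rewrite ger0_norm ?(le_trans (h0 0%R) (hM 0%R))// ltW].
Qed.

(** By Lebesgue's differentiation theorem. At the left endpoint the two-sided
    derivative may fail to be [h a], but a point is negligible. *)
Lemma primitive_derive (b : R) :
  {ae leb1, forall x, `[a, b]%classic x -> derive1 (primitive : R -> R^o) x = h x}.
Proof.
have li : locally_integrable setT h.
  split => //; first exact: openT.
  move=> K _ cK; have mK := compact_measurable cK.
  apply: (@le_lt_trans _ _ (\int[lebesgue_measure]_(x in K) (cst M%:E x))).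
    by apply: ge0_integral_homo => x _ //=; rewrite lee_fin ger0_norm.
  rewrite integral_cst//; have M0 : (0 <= M)%R := le_trans (h0 0%R) (hM 0%R).
  by rewrite lte_mul_pinfty//; exact: compact_finite_measure.
have na : {ae leb1, forall x : R, x != a}.
  exists [set a]; split => //; first exact: lebesgue_measure_set1.
  by move=> x /= /negP; rewrite negbK => /eqP.
have := @FTC1 R h (BLeft a) (fun y => integrable_bounded_itv a y) li.
apply: (@filterS2 _ _ (ae_filter_ringOfSetsType leb1) _ _ _ _ na) => x xa H.
rewrite /= in_itv/= => /andP[ax _].
have [|_ <-] := H; first by rewrite lte_fin lt_neqAle eq_sym xa.
by [].
Qed.

End primitive.

(** * Masses of intervals *)

Section weight_masses.
Context {R : realType}.
Variables (a b : R) (nu : R -> R).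
Hypothesis hnu : weight (T := measurableTypeR R) `[a, b] nu.

Lemma weight_ge0 x : (a <= x <= b)%R -> (0 <= nu x)%R.
Proof. by move=> xab; apply: hnu.2; rewrite /= in_itv. Qed.

Lemma subitv (s t : R) : (a <= s)%R -> (t <= b)%R -> `[s, t] `<=` `[a, b].
Proof.
move=> sa tb x /=; rewrite !in_itv/= => /andP[sx xt].
by rewrite (le_trans sa)// (le_trans xt).
Qed.

Lemma measurable_weight (s t : R) : (a <= s)%R -> (t <= b)%R ->
  measurable_fun `[s, t] nu.
Proof. by move=> sa tb; apply: measurable_funS hnu.1 => //; exact: subitv. Qed.

Lemma imass_ge0 (s t : R) : (a <= s)%R -> (t <= b)%R -> 0 <= imass nu s t.
Proof.
move=> sa tb; apply: integral_ge0 => x /(subitv sa tb) /=.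
by rewrite in_itv/= => /weight_ge0.
Qed.

Lemma imass_le (s t s' t' : R) : (a <= s)%R -> (t <= b)%R ->
  (s <= s')%R -> (t' <= t)%R -> imass nu s' t' <= imass nu s t.
Proof.
move=> sa tb ss tt; have I0 x : `[s, t]%classic x -> 0 <= (nu x)%:E.
  by move=> /(subitv sa tb)/=; rewrite in_itv/= => /weight_ge0.
have ssub : `[s', t'] `<=` `[s, t].
  by move=> x /=; rewrite !in_itv/= => /andP[sx xt]; rewrite (le_trans ss)// (le_trans xt).
by apply: ge0_integral_homo_sub => // x /ssub; exact: I0.
Qed.

Lemma imass_split (t : R) : (a <= t <= b)%R ->
  imass nu a t + imass nu t b = imass nu a b.
Proof.
move=> /andP[at_ tb]; rewrite /imass /wmass.
have -> : `[a, b]%classic = `[a, t] `|` `]t, b] :> set R.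
  by rewrite -itv_bndbnd_setU ?bnd_simp.
have sub : `]t, b] `<=` `[t, b] by move=> x /=; rewrite !in_itv/= => /andP[/ltW-> ->].
have m1 : measurable_fun `[a, t] nu by exact: measurable_weight.
have m2 : measurable_fun `]t, b] nu.
  by apply: measurable_funS (measurable_weight at_ (lexx b)).
rewrite ge0_integral_setU//=.
- congr (_ + _); rewrite /leb1 integral_itv_obnd_cbnd//; exact/measurable_EFinP.
- by apply/measurable_EFinP/measurable_funU.
- move=> x [|/sub] /=; rewrite !in_itv/= => /andP[h1 h2]; rewrite lee_fin weight_ge0//.
    by rewrite h1 (le_trans h2).
  by rewrite (le_trans at_)// h2.
- apply/disj_setPS => y [] /=; rewrite !in_itv/= => /andP[_ yx] /andP[].
  by rewrite ltNge yx.
Qed.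

Hypothesis nufin : imass nu a b < +oo.

Lemma imass_fin (s t : R) : (a <= s)%R -> (t <= b)%R ->
  imass nu s t \is a fin_num.
Proof.
move=> sa tb; rewrite ge0_fin_numE ?imass_ge0//.
by apply: le_lt_trans nufin; exact: imass_le.
Qed.

Lemma measurable_imassl : measurable_fun `[a, b] (fun t => fine (imass nu a t)).
Proof.
pose G t := \int[leb1]_(x in `[a, t]) ((nu \_ `[a, b]) x)%:E.
have n0 x : 0 <= ((nu \_ `[a, b]) x)%:E.
  rewrite patchE lee_fin; case: ifPn => // /set_mem/=.
  by rewrite in_itv; exact: weight_ge0.
have Gle s t : (s <= t)%R -> G s <= G t.
  move=> st; apply: ge0_integral_homo_sub => // x /=.
  by rewrite !in_itv/= => /andP[-> /le_trans]; exact.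
have Gfin t : G t \is a fin_num.
  rewrite ge0_fin_numE; last exact: integral_ge0.
  apply: le_lt_trans nufin; rewrite /imass /wmass.
  rewrite [leRHS]integral_mkcond restrict_EFin.
  by apply: ge0_integral_homo_sub => // x _; exact: n0.
have : measurable_fun `[a, b] (fun t => fine (G t)).
  apply: nondecreasing_measurable => // s t st.
  by rewrite fine_le ?Gfin// Gle.
apply: eq_measurable_fun => t /set_mem/=; rewrite in_itv/= => /andP[_ tb].
congr fine; apply: eq_integral => x /set_mem/= xat; rewrite patchE mem_set//=.
exact: (subitv (lexx a) tb).
Qed.

Lemma measurable_imassr : measurable_fun `[a, b] (fun t => fine (imass nu t b)).
Proof.
have : measurable_fun `[a, b] (fun t => fine (imass nu a b) - fine (imass nu a t))%R.
  by apply: measurable_funB => //; exact: measurable_imassl.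
apply: eq_measurable_fun => t /set_mem/=; rewrite in_itv/= => tab.
have [at_ tb] := andP tab.
rewrite -(imass_split tab) fineD ?imass_fin//.
by rewrite addrAC subrr add0r.
Qed.

(** Tonelli's theorem on the triangle [t <= y]. *)
Lemma integral_primitive_weight (M : R) (h : R -> R) :
  measurable_fun setT h -> (forall x, (0 <= h x)%R) -> (forall x, (h x <= M)%R) ->
  \int[leb1]_(y in `[a, b]) (primitive a h y * nu y)%:E =
  \int[leb1]_(t in `[a, b]) ((h t)%:E * imass nu t b).
Proof.
move=> mh h0 hM.
pose F (z : R * R) : \bar R := ((nu \_ `[a, b]) z.1 *
  (if (a <= z.2)%R && (z.2 <= z.1)%R then h z.2 else 0))%:E.
have n0 x : (0 <= (nu \_ `[a, b]) x)%R.
  rewrite patchE; case: ifPn => // /set_mem/=.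
  by rewrite in_itv; exact: weight_ge0.
have mnu : measurable_fun setT (nu \_ `[a, b]).
  by apply/(measurable_restrictT _ _).1 => //; exact: measurable_weight.
have mF : measurable_fun setT F.
  apply/measurable_EFinP/measurable_funM; first exact: (measurableT_comp mnu).
  apply: measurable_fun_ifT => //; last exact: (measurableT_comp mh).
  apply: measurable_and; apply: measurable_fun_ler => //.
have F0 z : 0 <= F z by rewrite lee_fin mulr_ge0//; case: ifP.
have := fubini_tonelli (m1 := @lebesgue_measure R) (m2 := @lebesgue_measure R) F mF F0.
rewrite /F/= => FT.
transitivity (\int[leb1]_x (\int[leb1]_y F (x, y))).
  rewrite integral_mkcond; apply: eq_integral => y _.
  rewrite patchE /F/=; case: ifPn => yab; last first.
    by rewrite patchE (negbTE yab); under eq_integral do rewrite mul0r; rewrite integral0.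
  under eq_integral do rewrite EFinM.
  rewrite ge0_integralZl//; last 3 first.
  - apply/measurable_EFinP; apply: measurable_fun_ifT => //.
    by apply: measurable_and; apply: measurable_fun_ler.
  - by move=> x _; case: ifP; rewrite lee_fin.
  - by rewrite lee_fin.
  rewrite patchE yab EFinM muleC (EFin_primitive a mh h0 hM); congr (_ * _).
  rewrite [LHS]integral_mkcond; apply: eq_integral => x _; rewrite patchE /=.
  by rewrite mem_setE in_itv/=; case: ifP.
transitivity (\int[leb1]_y (\int[leb1]_x F (x, y))); first exact: FT.
rewrite [RHS]integral_mkcond; apply: eq_integral => t _.
rewrite patchE /F/=; case: ifPn => [/set_mem/=|]; rewrite ?in_itv/= => tab; last first.
  rewrite integral0_eq// => x _; rewrite patchE mem_setE in_itv/=.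
  case: ifPn => xab; last by rewrite mul0r.
  case: ifPn => tax; last by rewrite mulr0.
  exfalso; move: tab; rewrite notin_setE /= in_itv/=; apply.
  by have [-> /le_trans ->//] := andP tax; case/andP: xab.
have [at_ tb] := andP tab.
rewrite at_/= /imass /wmass [in RHS]integral_mkcond -ge0_integralZl//=; last 3 first.
- apply/(measurable_restrictT _ _).1 => //.
  by apply/measurable_EFinP; exact: measurable_weight.
- move=> x _; rewrite patchE; case: ifPn => // /set_mem/=; rewrite in_itv/= => /andP[tx xb].
  by rewrite lee_fin weight_ge0// xb (le_trans at_).
- by rewrite lee_fin.
apply: eq_integral => x _; rewrite !patchE !mem_setE !in_itv/=.
case: (leP t x) => tx /=; last by rewrite mulr0 mule0.
by rewrite (le_trans at_ tx)/=; case: ifP => _; rewrite ?mul0r ?mule0// mulrC EFinM.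
Qed.

End weight_masses.

(** * Bounds for gauge norms *)

Section gauge_norms.
Context {d : measure_display} {T : measurableType d} {R : realType}.
Variables (m : {measure set T -> \bar R}) (Phi : R -> R).
Hypothesis hPhi : young_function Phi.
Implicit Types (D A : set T) (f w : T -> R).

Lemma gauge_norm_ge0 D w (F : T -> \bar R) : 0 <= gauge_norm m D Phi w F.
Proof.
by apply: le_ereal_inf_tmp => _ [k [k0 _] <-]; rewrite lee_fin ltW.
Qed.

Lemma gauge_norm_cst_le D w (N k1 : R) : measurable D -> measurable_fun D w ->
  (forall x, D x -> (0 <= w x)%R) -> (0 <= N)%R -> (0 < k1)%R ->
  (Phi (1 / k1))%:E * wmass m D w <= 1 ->
  gauge_norm m D Phi w (fun=> N%:E) <= (k1 * N)%:E.
Proof.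
move=> mD mw w0 N0 k10 adm.
suff H (k : R) : (0 < k)%R -> (k1 * N <= k)%R ->
    gauge_norm m D Phi w (fun=> N%:E) <= k%:E.
  apply/lee_addgt0Pr => e e0; rewrite -EFinD; apply: H; last by rewrite lerDl ltW.
  by rewrite ltr_wpDl// mulr_ge0// ltW.
move=> k0 Nk; apply: ge_ereal_inf; exists k%:E => //; exists k => //; split => //.
rewrite /wintegral inver gt_eqF//= ge0_integralZl//; last 2 first.
- exact/measurable_EFinP.
- by rewrite lee_fin (young_ge0 hPhi).
apply: le_trans adm; rewrite lee_wpmul2r//.
  by apply: integral_ge0 => x Dx; rewrite lee_fin w0.
rewrite lee_fin (young_homo hPhi)// ?divr_ge0// ?(ltW k0)//.
by rewrite ler_pdivrMr// mul1r mulrC ler_pdivlMr// mulrC.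
Qed.

(** Any scale above the gauge norm of [f] bounds the modular over the whole of
    [D], hence over a set [A], where it is explicit if [|f|] is constant. *)
Lemma gauge_norm_lt_mass D A w f (c k : R) : A `<=` D -> measurable A ->
  measurable_fun A w -> (forall x, D x -> (0 <= w x)%R) -> (0 <= c)%R ->
  (forall x, A x -> `|f x|%R = c) ->
  gauge_norm m D Phi w (EFin \o f) < k%:E ->
  (Phi (c / k))%:E * wmass m A w <= 1.
Proof.
move=> AD mA mw w0 c0 fc /ereal_inf_lt[_ [k0 [k00 adm] <-]]; rewrite lte_fin => k0k.
have kgt0 : (0 < k)%R by rewrite (lt_trans k00).
apply: le_trans adm; rewrite /wmass -ge0_integralZl//; last 3 first.
- exact/measurable_EFinP.
- by move=> x Ax; rewrite lee_fin w0//; exact: AD.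
- by rewrite lee_fin (young_ge0 hPhi).
rewrite /wintegral inver gt_eqF//; apply: ge0_integral_homo_sub => // x Ax.
- by rewrite mule_ge0 ?lee_fin ?(young_ge0 hPhi)// w0//; exact: AD.
- by rewrite /= mule_ge0 ?lee_fin ?(young_ge0 hPhi)// w0.
- rewrite /= lee_wpmul2r ?lee_fin ?w0//; first exact: AD.
  rewrite -(young_normr hPhi (f x / k0)) normrM fc// gtr0_norm ?invr_gt0//.
  rewrite (young_homo hPhi) ?divr_ge0 ?(ltW kgt0)//.
  by rewrite ler_wpM2l// lef_pV2// ltW.
Qed.

Hypothesis Phi_inv : young_invertible Phi.

(** When the mass of [A] for the two-dimensional weight is the product of the
    one-dimensional mass [W] with the mass [M2] of the other factor, the latter
    is absorbed by a dilation of the argument of [Phi], thanks to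
    [Phi (theta * t) <= theta * Phi t] for [theta = min 1 M2]. *)
Lemma gauge_norm_slab D A w f (c B M2 : R) (W : \bar R) :
  A `<=` D -> measurable A ->
  measurable_fun A w -> (forall x, D x -> (0 <= w x)%R) -> (0 <= c)%R ->
  (forall x, A x -> `|f x|%R = c) ->
  0 <= W -> W < +oo -> (0 < M2)%R -> wmass m A w = W * M2%:E ->
  (0 <= B)%R -> gauge_norm m D Phi w (EFin \o f) <= B%:E ->
  (young_inv Phi W^-1)^-1 * c%:E <= ((Num.min 1 M2)^-1 * B)%R%:E.
Proof.
move=> AD mA mw w0 c0 fc W0 Woo M20 WE B0 nB.
set th := Num.min 1%R M2; have th0 : (0 < th)%R by rewrite lt_min ltr01.
have [g g0 gE] := gauge_coef_fin hPhi Phi_inv W0 Woo.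
suff H (k : R) : (B < k)%R -> (g * c <= th^-1 * k)%R.
  rewrite gE -EFinM lee_fin; apply/ler_addgt0Pr => e e0.
  have := H (B + th * e)%R; rewrite mulrDr mulKf ?gt_eqF//; apply.
  by rewrite ltrDl mulr_gt0.
move=> Bk; have k0 : (0 < k)%R by rewrite (le_lt_trans B0).
have adm : (Phi (c / k))%:E * wmass m A w <= 1.
  apply: (gauge_norm_lt_mass AD mA mw w0 c0 fc).
  by apply: (le_lt_trans nB); rewrite lte_fin.
rewrite -lee_fin EFinM -gE; apply: gauge_coef_le => //.
  by rewrite mulr_gt0 ?invr_gt0.
apply: le_trans adm; rewrite WE muleA (muleAC _ W) lee_wpmul2r// -EFinM lee_fin.
have -> : (c / (th^-1 * k) = th * (c / k))%R by rewrite invfM invrK mulrCA.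
have thP : (0 <= th <= 1)%R by rewrite ltW// ge_min lexx.
apply: (le_trans (young_contract hPhi _ thP)); rewrite mulrC ler_wpM2l ?(young_ge0 hPhi)//.
by rewrite ge_min lexx orbT.
Qed.

End gauge_norms.

(** * Oscillation of primitives around their average *)

Section oscillation.
Context {R : realType}.

Lemma wLp_norm0 (e f p : R) (w : R -> R) : (0 < p)%R ->
  wLp_norm leb1 `[e, f] p w (fun=> 0%:E) = 0.
Proof.
move=> p0; rewrite /wLp_norm /wintegral integral0_eq; last first.
  by move=> x _; rewrite abse0 poweR0r ?mul0e// gt_eqF.
by rewrite poweR0r// invr_eq0 gt_eqF.
Qed.

Lemma wLp_norm_ge0 (e f p : R) (w : R -> R) F :
  0 <= wLp_norm leb1 `[e, f] p w F.
Proof. exact: poweR_ge0. Qed.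

Lemma wLp_norm_cst (e f s N : R) (w : R -> R) :
  weight (T := measurableTypeR R) `[e, f] w -> (0 < s)%R -> (0 <= N)%R ->
  wLp_norm leb1 `[e, f] s w (fun=> N%:E) = N%:E * imass w e f `^ s^-1.
Proof.
move=> hw s0 N0; rewrite /wLp_norm /wintegral.
rewrite ge0_integralZl//; last 3 first.
- by apply/measurable_EFinP; exact: hw.1.
- by move=> x xI; rewrite lee_fin hw.2.
- exact: poweR_ge0.
rewrite poweRM ?poweR_ge0//; last exact: (imass_ge0 hw).
by rewrite gee0_abs ?lee_fin// -poweRrM divff ?gt_eqF// poweRe1 ?lee_fin.
Qed.

(** The one-dimensional consequence of the inequality, for primitives of bounded
    nonnegative functions. Only intervals on which the oscillation is constant
    matter, and there the gauge norm is explicit. *)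
Definition oscillation_bound (a b p : R) (Phi mu nu w : R -> R) (C : R) :=
  forall (M : R) (h : R -> R), measurable_fun setT h ->
  (forall x, (0 <= h x)%R) -> (forall x, (h x <= M)%R) ->
  forall s t c : R, (a <= s)%R -> (t <= b)%R -> (0 <= c)%R ->
  (forall y, (s <= y <= t)%R ->
    `|primitive a h y - waverage leb1 `[a, b] nu (primitive a h)|%R = c) ->
  (young_inv Phi (imass mu s t)^-1)^-1 * c%:E <=
  C%:E * wLp_norm leb1 `[a, b] p w (EFin \o h).

(** The derivative of the primitive is almost everywhere equal to [h]. *)
Lemma wLp_norm_derive (a b p M : R) (w h : R -> R) :
  weight (T := measurableTypeR R) `[a, b] w -> (0 < p)%R ->
  measurable_fun setT h ->
  (forall x, (0 <= h x)%R) -> (forall x, (h x <= M)%R) ->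
  wLp_norm leb1 `[a, b] p w (EFin \o (derive1 (primitive a h : R -> R^o))) <=
  wLp_norm leb1 `[a, b] p w (EFin \o h).
Proof.
move=> [mw w0] p0 mh h0 hM; rewrite /wLp_norm /wintegral.
have int0 (F : R -> \bar R) :
    0 <= \int[leb1]_(x in `[a, b]) (`|F x| `^ p * (w x)%:E).
  by apply: integral_ge0 => x xab; rewrite mule_ge0 ?poweR_ge0// lee_fin w0.
apply: gt0_ler_poweR; rewrite ?invr_ge0 ?(ltW p0)// ?in_itv.
- by apply/andP; split; [exact: int0|exact: leey].
- by apply/andP; split; [exact: int0|exact: leey].
apply: ge0_integral_homo_ae => //.
- apply: emeasurable_funM; last exact/measurable_EFinP.
  apply: (measurableT_comp (measurable_poweR p)).
  apply: measurableT_comp => //.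
  by apply/measurable_EFinP; exact: measurable_funTS.
- by move=> x xab; rewrite mule_ge0 ?poweR_ge0// lee_fin w0.
- by move=> x xab; rewrite mule_ge0 ?poweR_ge0// lee_fin w0.
- have := primitive_derive a mh h0 hM b.
  apply: (@filterS _ _ (ae_filter_ringOfSetsType leb1)) => x H xab.
  by rewrite /= H.
Qed.

End oscillation.

(** * Averages of functions of one variable *)

Section averages.
Context {R : realType}.
Variables (a b c d : R) (nu1 nu2 : R -> R).
Hypothesis hnu1 : weight (T := measurableTypeR R) `[a, b] nu1.
Hypothesis hnu2 : weight (T := measurableTypeR R) `[c, d] nu2.
Hypothesis nu1oo : imass nu1 a b < +oo.
Hypothesis nu2oo : imass nu2 c d < +oo.

Lemma wintegral_primitive_fin (M : R) (h : R -> R) :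
  measurable_fun setT h -> (forall x, (0 <= h x)%R) -> (forall x, (h x <= M)%R) ->
  wintegral leb1 `[a, b] nu1 (EFin \o primitive a h) \is a fin_num.
Proof.
move=> mh h0 hM; rewrite ge0_fin_numE; last first.
  apply: integral_ge0 => x xab; rewrite mule_ge0 ?lee_fin ?(primitive_ge0 a h0)//.
  by rewrite hnu1.2.
apply: (@le_lt_trans _ _ (\int[leb1]_(x in `[a, b]) ((primitive a h b)%:E * (nu1 x)%:E))).
  apply: ge0_integral_homo => x xab /=.
    by rewrite lee_fin mulr_ge0 ?(primitive_ge0 a h0)//; exact: hnu1.2.
  rewrite lee_fin ler_wpM2r ?(hnu1.2 _ xab)//.
  by apply: (primitive_homo a mh h0 hM); move: xab; rewrite /= in_itv/= => /andP[].
rewrite ge0_integralZl//; last 3 first.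
- by apply/measurable_EFinP; exact: hnu1.1.
- by move=> x xab; rewrite lee_fin; exact: hnu1.2.
- by rewrite lee_fin (primitive_ge0 a h0).
by rewrite lte_mul_pinfty// ?lee_fin ?(primitive_ge0 a h0).
Qed.

Lemma waverage_fst (M : R) (h : R -> R) :
  measurable_fun setT h -> (forall x, (0 <= h x)%R) -> (forall x, (h x <= M)%R) ->
  0 < imass nu2 c d ->
  waverage leb2 (`[a, b] `*` `[c, d]) (prod_weight nu1 nu2)
    (fun z => primitive a h z.1) = waverage leb1 `[a, b] nu1 (primitive a h).
Proof.
move=> mh h0 hM nu2gt0; rewrite /waverage.
have gfin := wintegral_primitive_fin mh h0 hM.
have f1 : imass nu1 a b \is a fin_num by exact: (imass_fin hnu1).
have f2 : imass nu2 c d \is a fin_num by exact: (imass_fin hnu2).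
rewrite wmass_prod_weight//; [|exact: hnu1.1|exact: hnu2.1|exact: hnu1.2|exact: hnu2.2].
have -> : wintegral leb2 (`[a, b] `*` `[c, d]) (prod_weight nu1 nu2)
    (EFin \o (fun z => primitive a h z.1)) =
    wintegral leb1 `[a, b] nu1 (EFin \o primitive a h) * imass nu2 c d.
  rewrite /wintegral /imass /wmass.
  under [LHS]eq_integral do rewrite /= /prod_weight -EFinM mulrA.
  rewrite (@integral_prod_weight _ _ _ (fun x => (primitive a h x * nu1 x)%R))//.
  - apply: measurable_funM; last exact: hnu1.1.
    exact: (measurable_primitive a mh h0 hM).
  - exact: hnu2.1.
  - by move=> x xab; rewrite mulr_ge0 ?(primitive_ge0 a h0)//; exact: hnu1.2.
  - exact: hnu2.2.
rewrite -/(imass nu1 a b) -/(imass nu2 c d) !fineM// -mulf_div divff ?mulr1//.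
by rewrite gt_eqF// -lte_fin fineK.
Qed.

Lemma waverage_snd (M : R) (h : R -> R) : 
  measurable_fun setT h -> (forall x, (0 <= h x)%R) -> (forall x, (h x <= M)%R) ->
  0 < imass nu2 c d ->
  waverage leb2 (`[c, d] `*` `[a, b]) (prod_weight nu2 nu1)
    (fun z => primitive a h z.2) = waverage leb1 `[a, b] nu1 (primitive a h).
Proof.
move=> mh h0 hM nu2gt0; rewrite /waverage.
have gfin := wintegral_primitive_fin mh h0 hM.
have f1 : imass nu1 a b \is a fin_num by exact: (imass_fin hnu1).
have f2 : imass nu2 c d \is a fin_num by exact: (imass_fin hnu2).
rewrite wmass_prod_weight//; [|exact: hnu2.1|exact: hnu1.1|exact: hnu2.2|exact: hnu1.2].
have -> : wintegral leb2 (`[c, d] `*` `[a, b]) (prod_weight nu2 nu1)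
    (EFin \o (fun z => primitive a h z.2)) =
    imass nu2 c d * wintegral leb1 `[a, b] nu1 (EFin \o primitive a h).
  rewrite /wintegral /imass /wmass.
  under [LHS]eq_integral do rewrite /= /prod_weight -EFinM mulrCA.
  rewrite (@integral_prod_weight _ _ _ _ (fun x => (primitive a h x * nu1 x)%R))//.
  - exact: hnu2.1.
  - apply: measurable_funM; last exact: hnu1.1.
    exact: (measurable_primitive a mh h0 hM).
  - exact: hnu2.2.
  - by move=> x xab; rewrite mulr_ge0 ?(primitive_ge0 a h0)//; exact: hnu1.2.
rewrite -/(imass nu1 a b) -/(imass nu2 c d) !fineM// -mulf_div divff ?mul1r//.
by rewrite gt_eqF// -lte_fin fineK.
Qed.

End averages.

(** * From the rectangle to its sides *)

Section oscillation_from_rectangle.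
Context {R : realType}.
Variables (a b c d : R) (mu1 mu2 nu1 nu2 w1 w2 : R -> R) (p1 p2 s1 : R) (Phi : R -> R).
Let I := `[a, b]%classic.
Let J := `[c, d]%classic.
Hypothesis hmu1 : weight (T := measurableTypeR R) I mu1.
Hypothesis hmu2 : weight (T := measurableTypeR R) J mu2.
Hypothesis hnu1 : weight (T := measurableTypeR R) I nu1.
Hypothesis hnu2 : weight (T := measurableTypeR R) J nu2.
Hypothesis hw1 : weight (T := measurableTypeR R) I w1.
Hypothesis hw2 : weight (T := measurableTypeR R) J w2.
Hypothesis mu1P : 0 < imass mu1 a b < +oo.
Hypothesis mu2P : 0 < imass mu2 c d < +oo.
Hypothesis nu1P : 0 < imass nu1 a b < +oo.
Hypothesis nu2P : 0 < imass nu2 c d < +oo.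
Hypotheses (hp1 : (1 <= p1)%R) (hp2 : (1 <= p2)%R) (hs1 : (1 <= s1)%R).
Hypotheses (hPhi : young_function Phi) (hPhi_inv : young_invertible Phi).
Variables (C1 C2 : R).
Hypotheses (hC1 : (0 < C1)%R) (hC2 : (0 < C2)%R).
Hypothesis poincare : forall f : R * R -> R, [lipschitz f x | x in I `*` J] ->
  gauge_norm leb2 (I `*` J) Phi (prod_weight mu1 mu2)
    (fun x => (f x - waverage leb2 (I `*` J) (prod_weight nu1 nu2) f)%:E)
  <= C1%:E * norm_Lp_gauge I J p1 Phi w1 mu2 (partial1 f)
   + C2%:E * (2%:E * (young_inv Phi (imass mu1 a b)^-1)^-1
              / imass nu1 a b `^ s1^-1)
     * norm_hat I J s1 p2 nu1 w2 (partial2 f).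

Lemma lipschitz_fst (g : R -> R) (M : R) :
  (forall y z, (a <= y)%R -> (a <= z)%R -> (`|g y - g z| <= M * `|y - z|)%R) ->
  (0 <= M)%R ->
  [lipschitz (fun z : R * R => g z.1) x | x in I `*` J].
Proof.
move=> H M0; exists M; split; first exact: num_real.
move=> k Mk -[u v]/= [[uI _] [vI _]].
move: uI vI; rewrite /I/= !in_itv/= => /andP[ua _] /andP[va _].
apply: (le_trans (H _ _ ua va)).
rewrite prod_normE/=; apply: ler_pM => //; first exact: ltW.
by rewrite le_max lexx.
Qed.

Lemma lipschitz_snd (g : R -> R) (M : R) :
  (forall y z, (c <= y)%R -> (c <= z)%R -> (`|g y - g z| <= M * `|y - z|)%R) ->
  (0 <= M)%R ->
  [lipschitz (fun z : R * R => g z.2) x | x in I `*` J].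
Proof.
move=> H M0; exists M; split; first exact: num_real.
move=> k Mk -[u v]/= [[_ uI] [_ vI]].
move: uI vI; rewrite /J/= !in_itv/= => /andP[ua _] /andP[va _].
apply: (le_trans (H _ _ ua va)).
rewrite prod_normE/=; apply: ler_pM => //; first exact: ltW.
by rewrite le_max lexx orbT.
Qed.

(** For [f z = g z.1], the inner norm of the first partial derivative does not
    depend on the second variable, so that its outer gauge norm is at most the
    inner norm times a scale [k1] which is admissible for the constant [1]. *)
Lemma oscillation_bound_fst :
  exists2 C : R, (0 < C)%R & oscillation_bound a b p1 Phi mu1 nu1 w1 C.
Proof.
have /andP[mu1gt0 mu1oo] := mu1P; have /andP[mu2gt0 mu2oo] := mu2P.
have /andP[nu1gt0 nu1oo] := nu1P; have /andP[nu2gt0 nu2oo] := nu2P.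
have [k1 k10 k1adm] := gauge_scale hPhi hPhi_inv mu2P.
set M2 := fine (imass mu2 c d).
have M2E : imass mu2 c d = M2%:E by rewrite fineK// (imass_fin hmu2).
have M20 : (0 < M2)%R by rewrite -lte_fin -M2E.
set th := Num.min 1%R M2; have th0 : (0 < th)%R by rewrite lt_min ltr01.
exists (th^-1 * (C1 * k1))%R; first by rewrite !mulr_gt0// invr_gt0.
move=> M h mh h0 hM s t m0 sa tb m00 osc.
set N := wLp_norm leb1 `[a, b] p1 w1 (EFin \o h).
have p10 : (0 < p1)%R by rewrite (lt_le_trans _ hp1).
have s10 : (0 < s1)%R by rewrite (lt_le_trans _ hs1).
have p20 : (0 < p2)%R by rewrite (lt_le_trans _ hp2).
have N0 : 0 <= N := wLp_norm_ge0 _ _ _ _ _.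
have M0 : (0 <= M)%R := le_trans (h0 0%R) (hM 0%R).
have [Noo|Nfin] := eqVneq N +oo.
  by rewrite Noo mulry gtr0_sg ?mul1e ?leey// !mulr_gt0// invr_gt0.
have NE : N = (fine N)%:E by rewrite fineK// ge0_fin_numE// lt_neqAle Nfin leey.
pose f (z : R * R) := primitive a h z.1.
have lipf : [lipschitz f x | x in I `*` J].
  exact: (lipschitz_fst (primitive_lip mh h0 hM)).
have := poincare lipf.
rewrite (waverage_fst hnu1 hnu2 nu1oo nu2oo mh h0 hM nu2gt0).
have -> : norm_hat I J s1 p2 nu1 w2 (partial2 f) = 0.
  transitivity (wLp_norm leb1 I s1 nu1 (fun=> 0%:E)); last exact: wLp_norm0.
  congr wLp_norm; apply/funext => x.
  transitivity (wLp_norm leb1 J p2 w2 (fun=> 0%:E)); last exact: wLp_norm0.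
  by congr wLp_norm; apply/funext => y; rewrite /partial2 /f/= derive1_cst.
rewrite mule0 adde0 => /le_trans H.
have B : gauge_norm leb2 (I `*` J) Phi (prod_weight mu1 mu2)
    (EFin \o (fun x => (f x - waverage leb1 `[a, b] nu1 (primitive a h))%R))
    <= (C1 * (k1 * fine N))%:E.
  apply: H; rewrite EFinM lee_wpmul2l ?lee_fin ?(ltW hC1)//.
  set N' := wLp_norm leb1 `[a, b] p1 w1 (EFin \o (derive1 (primitive a h : R -> R^o))).
  have N'N : N' <= N by exact: (wLp_norm_derive hw1 p10 mh h0 hM).
  have [n n0 N'E] : exists2 n : R, (0 <= n)%R & N' = n%:E.
    have N'0 : 0 <= N' := wLp_norm_ge0 _ _ _ _ _.
    exists (fine N'); first exact: fine_ge0.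
    by rewrite fineK// ge0_fin_numE// (le_lt_trans N'N)// NE ltry.
  have -> : norm_Lp_gauge I J p1 Phi w1 mu2 (partial1 f) =
     gauge_norm leb1 J Phi mu2 (fun=> n%:E) by rewrite -N'E.
  have gle := gauge_norm_cst_le (m := leb1) hPhi (measurable_itv `[c, d]) hmu2.1 hmu2.2 n0 k10 k1adm.
  apply: (le_trans gle); rewrite lee_fin ler_wpM2l ?(ltW k10)//.
  by rewrite -lee_fin -N'E -NE.
have AD : `[s, t] `*` J `<=` I `*` J.
  by move=> z [z1 z2]; split => //; exact: (subitv sa tb).
have mA : measurable (`[s, t] `*` J) by apply: measurableX; exact: measurable_itv.
have mw : measurable_fun (`[s, t] `*` J) (prod_weight mu1 mu2).
  apply: measurable_funM.
    apply: (measurable_comp (F := `[s, t])) => //.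
    - by move=> _ [z [z1 z2] <-].
    - exact: (measurable_weight hmu1).
    - exact: measurable_funTS.
  apply: (measurable_comp (F := J)) => //; first exact: measurable_itv.
  - by move=> _ [z [z1 z2] <-].
  - exact: hmu2.1.
  - exact: measurable_funTS.
have w0 z : (I `*` J) z -> (0 <= prod_weight mu1 mu2 z)%R.
  by move=> [z1 z2]; rewrite /prod_weight mulr_ge0//; [exact: hmu1.2|exact: hmu2.2].
have oscA z : (`[s, t] `*` J) z ->
    `|f z - waverage leb1 `[a, b] nu1 (primitive a h)|%R = m0.
  by move=> [/= + _]; rewrite in_itv/= => /osc.
have W0 : 0 <= imass mu1 s t := imass_ge0 hmu1 sa tb.
have Woo : imass mu1 s t < +oo by rewrite -ge0_fin_numE// (imass_fin hmu1).
have WE : wmass leb2 (`[s, t] `*` J) (prod_weight mu1 mu2) = imass mu1 s t * M2%:E.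
  rewrite -M2E; exact: (wmass_prod_weight (measurable_itv `[s, t])
    (measurable_itv `[c, d]) (measurable_weight hmu1 sa tb) hmu2.1
    (fun x xst => hmu1.2 _ (subitv sa tb xst)) hmu2.2).
have Bge0 : (0 <= C1 * (k1 * fine N))%R.
  by rewrite !mulr_ge0 ?(ltW hC1) ?(ltW k10)// fine_ge0.
have slab := gauge_norm_slab (m := leb2) hPhi hPhi_inv AD mA mw w0 m00 oscA W0 Woo M20 WE Bge0 B.
apply: (le_trans slab).
by rewrite NE -EFinM -!mulrA.
Qed.

(** For [f z = g z.2], the outer norm of the second partial derivative is the
    inner one times [nu1(I)^(1/s1)], and the coefficient in front of it is a real
    number because [mu1(I)] and [nu1(I)] are positive and finite. *)
Lemma oscillation_bound_snd :
  exists2 C : R, (0 < C)%R & oscillation_bound c d p2 Phi mu2 nu2 w2 C.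
Proof.
have /andP[mu1gt0 mu1oo] := mu1P; have /andP[mu2gt0 mu2oo] := mu2P.
have /andP[nu1gt0 nu1oo] := nu1P; have /andP[nu2gt0 nu2oo] := nu2P.
have [k1 k10 k1adm] := gauge_scale hPhi hPhi_inv mu2P.
set M1 := fine (imass mu1 a b).
have M1E : imass mu1 a b = M1%:E by rewrite fineK// (imass_fin hmu1).
have M10 : (0 < M1)%R by rewrite -lte_fin -M1E.
set th := Num.min 1%R M1; have th0 : (0 < th)%R by rewrite lt_min ltr01.
have [g g0 gE] := gauge_coef_fin hPhi hPhi_inv (ltW mu1gt0) mu1oo.
set V1 := fine (imass nu1 a b).
have V1E : imass nu1 a b = V1%:E by rewrite fineK// (imass_fin hnu1).
have V10 : (0 < V1)%R by rewrite -lte_fin -V1E.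
set x := (V1 `^ s1^-1)%R; have x0 : (0 < x)%R by rewrite powR_gt0.
set K := (C2 * (2 * g / x) * x)%R.
have K0 : (0 <= K)%R by rewrite !mulr_ge0// ?invr_ge0 ltW.
(* adding [1] makes the constant positive whatever [K >= 0] *)
exists (th^-1 * (K + 1))%R; first by rewrite mulr_gt0// ?invr_gt0// ltr_wpDl.
move=> M h mh h0 hM s t m0 sa tb m00 osc.
set N := wLp_norm leb1 `[c, d] p2 w2 (EFin \o h).
have p10 : (0 < p1)%R by rewrite (lt_le_trans _ hp1).
have s10 : (0 < s1)%R by rewrite (lt_le_trans _ hs1).
have p20 : (0 < p2)%R by rewrite (lt_le_trans _ hp2).
have N0 : 0 <= N := wLp_norm_ge0 _ _ _ _ _.
have M0 : (0 <= M)%R := le_trans (h0 0%R) (hM 0%R).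
have [Noo|Nfin] := eqVneq N +oo.
  by rewrite Noo mulry gtr0_sg ?mul1e ?leey// mulr_gt0// ?invr_gt0// ltr_wpDl.
have NE : N = (fine N)%:E by rewrite fineK// ge0_fin_numE// lt_neqAle Nfin leey.
pose f (z : R * R) := primitive c h z.2.
have lipf : [lipschitz f x | x in I `*` J].
  exact: (lipschitz_snd (primitive_lip mh h0 hM)).
have := poincare lipf.
rewrite (waverage_snd hnu2 hnu1 nu2oo nu1oo mh h0 hM nu1gt0).
have -> : norm_Lp_gauge I J p1 Phi w1 mu2 (partial1 f) = 0.
  apply/le_anti; rewrite gauge_norm_ge0 andbT.
  have -> : norm_Lp_gauge I J p1 Phi w1 mu2 (partial1 f) =
      gauge_norm leb1 J Phi mu2 (fun=> 0%:E).
    congr gauge_norm; apply/funext => y.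
    transitivity (wLp_norm leb1 I p1 w1 (fun=> 0%:E)); last exact: wLp_norm0.
    by congr wLp_norm; apply/funext => z; rewrite /partial1 /f/= derive1_cst.
  have := gauge_norm_cst_le (m := leb1) hPhi (measurable_itv `[c, d]) hmu2.1 hmu2.2 (lexx 0%R) k10 k1adm.
  by rewrite mulr0.
rewrite mule0 add0e => /le_trans H.
have B : gauge_norm leb2 (I `*` J) Phi (prod_weight mu1 mu2)
    (EFin \o (fun z => (f z - waverage leb1 `[c, d] nu2 (primitive c h))%R))
    <= (K * fine N)%:E.
  apply: H.
  set N' := wLp_norm leb1 `[c, d] p2 w2 (EFin \o (derive1 (primitive c h : R -> R^o))).
  have N'N : N' <= N by exact: (wLp_norm_derive hw2 p20 mh h0 hM).
  have [n n0 N'E] : exists2 n : R, (0 <= n)%R & N' = n%:E.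
    have N'0 : 0 <= N' := wLp_norm_ge0 _ _ _ _ _.
    exists (fine N'); first exact: fine_ge0.
    by rewrite fineK// ge0_fin_numE// (le_lt_trans N'N)// NE ltry.
  have -> : norm_hat I J s1 p2 nu1 w2 (partial2 f) =
     wLp_norm leb1 I s1 nu1 (fun=> n%:E) by rewrite -N'E.
  rewrite (wLp_norm_cst hnu1 s10 n0) gE V1E poweR_EFin -/x.
  rewrite inver gt_eqF// -!EFinM lee_fin /K mulrA -!mulrA.
  rewrite !ler_wpM2l ?invr_ge0 ?(ltW hC2) ?(ltW x0)// mulrC ler_wpM2l ?(ltW x0)//.
  by rewrite -lee_fin -N'E -NE.
have AD : I `*` `[s, t] `<=` I `*` J.
  by move=> z [z1 z2]; split => //; exact: (subitv sa tb).
have mA : measurable (I `*` `[s, t]) by apply: measurableX; exact: measurable_itv.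
have mw : measurable_fun (I `*` `[s, t]) (prod_weight mu1 mu2).
  apply: measurable_funM.
    apply: (measurable_comp (F := I)) => //; first exact: measurable_itv.
    - by move=> _ [z [z1 z2] <-].
    - exact: hmu1.1.
    - exact: measurable_funTS.
  apply: (measurable_comp (F := `[s, t])) => //.
  - by move=> _ [z [z1 z2] <-].
  - exact: (measurable_weight hmu2).
  - exact: measurable_funTS.
have w0 z : (I `*` J) z -> (0 <= prod_weight mu1 mu2 z)%R.
  by move=> [z1 z2]; rewrite /prod_weight mulr_ge0//; [exact: hmu1.2|exact: hmu2.2].
have oscA z : (I `*` `[s, t]) z ->
    `|f z - waverage leb1 `[c, d] nu2 (primitive c h)|%R = m0.
  by move=> [_ /=]; rewrite in_itv/= => /osc.
have W0 : 0 <= imass mu2 s t := imass_ge0 hmu2 sa tb.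
have Woo : imass mu2 s t < +oo by rewrite -ge0_fin_numE// (imass_fin hmu2).
have WE : wmass leb2 (I `*` `[s, t]) (prod_weight mu1 mu2) = imass mu2 s t * M1%:E.
  rewrite muleC -M1E; exact: (wmass_prod_weight (measurable_itv `[a, b])
    (measurable_itv `[s, t]) hmu1.1 (measurable_weight hmu2 sa tb) hmu1.2
    (fun x xst => hmu2.2 _ (subitv sa tb xst))).
have Bge0 : (0 <= K * fine N)%R by rewrite mulr_ge0// fine_ge0.
have slab := gauge_norm_slab (m := leb2) hPhi hPhi_inv AD mA mw w0 m00 oscA W0 Woo M10 WE Bge0 B.
apply: (le_trans slab).
rewrite NE -EFinM lee_fin -(mulrA _ (K + 1)%R) ler_wpM2l ?invr_ge0 ?(ltW th0)//.
have fN0 : (0 <= fine N)%R by exact: fine_ge0.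
by rewrite (ler_wpM2r fN0)// lerDl.
Qed.

End oscillation_from_rectangle.

(** * Hardy-type estimates *)

Section hardy.
Context {R : realType}.
Variables (a b p C : R) (Phi mu nu w : R -> R).
Hypothesis p0 : (0 < p)%R.
Hypothesis hnu : weight (T := measurableTypeR R) `[a, b] nu.
Hypothesis nuP : 0 < imass nu a b < +oo.
Hypothesis osc : oscillation_bound a b p Phi mu nu w C.

Let nutot := fine (imass nu a b).

Let nuoo : imass nu a b < +oo. Proof. by case/andP: nuP. Qed.

Let nuE : imass nu a b = nutot%:E.
Proof. by rewrite /nutot fineK// (imass_fin hnu nuoo). Qed.

Let nu0 : (0 < nutot)%R.
Proof. by rewrite -lte_fin -nuE; case/andP: nuP. Qed.

Lemma wLp_norm_patch (D : set R) (h : R -> R) : D `<=` `[a, b] ->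
  wLp_norm leb1 `[a, b] p w (EFin \o (h \_ D)) = wLp_norm leb1 D p w (EFin \o h).
Proof.
move=> Dab; rewrite /wLp_norm.
suff -> : wintegral leb1 `[a, b] w (fun x => `|(EFin \o h \_ D) x| `^ p) =
  wintegral leb1 D w (fun x => `|(EFin \o h) x| `^ p) by [].
rewrite /wintegral [LHS]integral_mkcond [RHS]integral_mkcond.
apply: eq_integral => x _.
rewrite !patchE /=; case: ifPn => xab.
  case: ifPn => xD; first by rewrite patchE xD.
  by rewrite patchE (negbTE xD) normr0 powR0 ?mul0e// gt_eqF.
by case: ifPn => // /set_mem /Dab /mem_set; rewrite (negbTE xab).
Qed.

(** By Fubini, the primitive of [h \_ D] has average [B / nutot], with [B] the
    integral of [h] against [nu[t, b]]. As [nu[a, t] + nu[t, b]] is the total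
    mass, the value of the primitive at [b], which is the integral of [h] over
    [D], exceeds this average by [A / nutot], with [A] the integral of [h]
    against [nu[a, t]]. *)
Lemma primitive_patch_average (D : set R) (M : R) (h : R -> R) :
  measurable D -> D `<=` `[a, b] -> measurable_fun setT h ->
  (forall x, (0 <= h x)%R) -> (forall x, (h x <= M)%R) ->
  exists A B : R, [/\ (0 <= A)%R, (0 <= B)%R &
   [/\ \int[leb1]_(t in D) (fine (imass nu a t) * h t)%:E = A%:E,
    \int[leb1]_(t in D) (fine (imass nu t b) * h t)%:E = B%:E,
    waverage leb1 `[a, b] nu (primitive a (h \_ D)) = (B / nutot)%R &
    (primitive a (h \_ D) b - B / nutot = A / nutot)%R]].
Proof.
move=> mD Dab mh h0 hM.
have M0 : (0 <= M)%R := le_trans (h0 0%R) (hM 0%R).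
have mh' : measurable_fun setT (h \_ D).
  by apply/(measurable_restrictT _ _).1 => //; exact: measurable_funTS.
have h'0 x : (0 <= (h \_ D) x)%R by rewrite patchE; case: ifP.
have h'M x : ((h \_ D) x <= M)%R by rewrite patchE; case: ifP.
have patch (V : R -> R) : \int[leb1]_(t in D) (V t * h t)%:E =
    \int[leb1]_(t in `[a, b]) (((h \_ D) t)%:E * (V t)%:E).
  rewrite [LHS]integral_mkcond [RHS]integral_mkcond; apply: eq_integral => x _.
  rewrite !patchE; case: ifPn => [xD|_].
    by rewrite (mem_set (Dab _ (set_mem xD))) -EFinM mulrC.
  by case: ifP => // _; rewrite mul0e.
pose Vl t := fine (imass nu a t); pose Vr t := fine (imass nu t b).
have fl t : `[a, b]%classic t -> imass nu a t = (Vl t)%:E.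
  by rewrite /= in_itv/= => /andP[at_ tb]; rewrite /Vl fineK// (imass_fin hnu nuoo).
have fr t : `[a, b]%classic t -> imass nu t b = (Vr t)%:E.
  by rewrite /= in_itv/= => /andP[at_ tb]; rewrite /Vr fineK// (imass_fin hnu nuoo).
have l0 t : `[a, b]%classic t -> (0 <= Vl t)%R.
  by rewrite /= in_itv/= => /andP[at_ tb]; rewrite fine_ge0// (imass_ge0 hnu).
have r0 t : `[a, b]%classic t -> (0 <= Vr t)%R.
  by rewrite /= in_itv/= => /andP[at_ tb]; rewrite fine_ge0// (imass_ge0 hnu).
have lr t : `[a, b]%classic t -> (Vl t + Vr t)%R = nutot.
  move=> tab; apply: EFin_inj; rewrite EFinD -fl// -fr// -nuE.
  by rewrite (imass_split hnu)//; move: tab; rewrite /= in_itv.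
have mVl : measurable_fun `[a, b] Vl by exact: (measurable_imassl hnu).
have mVr : measurable_fun `[a, b] Vr by exact: (measurable_imassr hnu).
have [XA XAE] : exists X, \int[leb1]_(t in D) (Vl t * h t)%:E = X by eexists.
have [XB XBE] : exists X, \int[leb1]_(t in D) (Vr t * h t)%:E = X by eexists.
have XA0 : 0 <= XA.
  by rewrite -XAE; apply: integral_ge0 => x /Dab xab; rewrite lee_fin mulr_ge0// l0.
have XB0 : 0 <= XB.
  by rewrite -XBE; apply: integral_ge0 => x /Dab xab; rewrite lee_fin mulr_ge0// r0.
have mh'ab : measurable_fun `[a, b] (fun t => ((h \_ D) t)%:E).
  by apply/measurable_EFinP; exact: measurable_funTS.
have sum : XA + XB = (primitive a (h \_ D) b * nutot)%:E.
  rewrite -XAE -XBE !patch -ge0_integralD//; last 4 first.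
  - by move=> x xab; rewrite mule_ge0 ?lee_fin// l0.
  - by apply: emeasurable_funM => //; exact/measurable_EFinP.
  - by move=> x xab; rewrite mule_ge0 ?lee_fin// r0.
  - by apply: emeasurable_funM => //; exact/measurable_EFinP.
  rewrite EFinM (EFin_primitive _ mh' h'0 h'M) -ge0_integralZr//; last 2 first.
  - by move=> x _; rewrite lee_fin.
  - by rewrite lee_fin ltW.
  by apply: eq_integral => t /set_mem tab; rewrite -!EFinM -EFinD -mulrDr lr.
have [A AE] : exists A, XA = A%:E.
  exists (fine XA); rewrite fineK// ge0_fin_numE//.
  by apply: (le_lt_trans (leeDl XA XB0)); rewrite sum ltry.
have [B BE] : exists B, XB = B%:E.
  exists (fine XB); rewrite fineK// ge0_fin_numE//.
  by apply: (le_lt_trans (leeDr XB XA0)); rewrite sum ltry.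
exists A, B; rewrite -!lee_fin -AE -BE; split => //; split => //.
- rewrite /waverage -[wmass _ _ _]/(imass nu a b) -/nutot; congr (_ / _)%R.
  suff -> : wintegral leb1 `[a, b] nu (EFin \o primitive a (h \_ D)) = XB by rewrite BE.
  rewrite /wintegral/= -XBE patch.
  under [LHS]eq_integral do rewrite /= -EFinM.
  rewrite (integral_primitive_weight hnu mh' h'0 h'M).
  by apply: eq_integral => t /set_mem tab; rewrite -fr.
- rewrite -(mulfK (lt0r_neq0 nu0) (primitive a (h \_ D) b)) -mulrBl; congr (_ / _)%R.
  by apply/eqP; rewrite subr_eq -eqe EFinD -sum AE BE.
Qed.

(** The test functions of both estimates: a primitive of a function supported in
    [[a, x]] is constant on [[x, b]], and one of a function supported in [[x, b]]
    vanishes on [[a, x]]. *)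
Lemma hardy_left (x M : R) (h : R -> R) : (a <= x <= b)%R ->
  measurable_fun setT h -> (forall y, (0 <= h y)%R) -> (forall y, (h y <= M)%R) ->
  (young_inv Phi (imass mu x b)^-1)^-1 *
    \int[leb1]_(t in `[a, x]) (fine (imass nu a t) * h t)%:E <=
  (C * fine (imass nu a b))%:E * wLp_norm leb1 `[a, x] p w (EFin \o h).
Proof.
move=> /andP[ax xb] mh h0 hM.
have Dab : `[a, x] `<=` `[a, b] by exact: subitv.
have mD : measurable `[a, x]%classic by [].
have [A [B [A0 B0 [AE BE avg diff]]]] := primitive_patch_average mD Dab mh h0 hM.
have mh' : measurable_fun setT (h \_ `[a, x]).
  by apply/(measurable_restrictT _ _).1 => //; exact: measurable_funTS.
have M0 : (0 <= M)%R := le_trans (h0 0%R) (hM 0%R).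
have h'0 y : (0 <= (h \_ `[a, x]) y)%R by rewrite patchE; case: ifP.
have h'M y : ((h \_ `[a, x]) y <= M)%R by rewrite patchE; case: ifP.
have prim y : (x <= y <= b)%R -> primitive a (h \_ `[a, x]) y = primitive a (h \_ `[a, x]) b.
  move=> /andP[xy yb]; apply: EFin_inj; rewrite !(EFin_primitive _ mh' h'0 h'M).
  rewrite [LHS]integral_mkcond [RHS]integral_mkcond; apply: eq_integral => t _.
  rewrite !patchE !mem_setE !in_itv/=; case: (leP a t) => //= _.
  case: (leP t x) => tx; first by rewrite (le_trans tx xy) (le_trans tx xb).
  by case: ifP; case: ifP.
have c0 : (0 <= A / nutot)%R by rewrite divr_ge0// ltW.
have := @osc M _ mh' h'0 h'M x b (A / nutot)%R ax (lexx b) c0.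
rewrite wLp_norm_patch// AE => H.
rewrite -/nutot (_ : A%:E = (A / nutot)%:E * nutot%:E); last first.
  by rewrite -EFinM divfK// gt_eqF.
rewrite muleA (EFinM C) (muleAC C%:E) lee_wpmul2r ?lee_fin ?(ltW nu0)//.
apply: H => y /prim ->.
by rewrite avg diff ger0_norm.
Qed.

Lemma hardy_right (x M : R) (h : R -> R) : (a <= x <= b)%R ->
  measurable_fun setT h -> (forall y, (0 <= h y)%R) -> (forall y, (h y <= M)%R) ->
  (young_inv Phi (imass mu a x)^-1)^-1 *
    \int[leb1]_(t in `[x, b]) (fine (imass nu t b) * h t)%:E <=
  (C * fine (imass nu a b))%:E * wLp_norm leb1 `[x, b] p w (EFin \o h).
Proof.
move=> /andP[ax xb] mh h0 hM.
have Dab : `[x, b] `<=` `[a, b] by exact: subitv.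
have mD : measurable `[x, b]%classic by [].
have [A [B [A0 B0 [AE BE avg diff]]]] := primitive_patch_average mD Dab mh h0 hM.
have mh' : measurable_fun setT (h \_ `[x, b]).
  by apply/(measurable_restrictT _ _).1 => //; exact: measurable_funTS.
have M0 : (0 <= M)%R := le_trans (h0 0%R) (hM 0%R).
have h'0 y : (0 <= (h \_ `[x, b]) y)%R by rewrite patchE; case: ifP.
have h'M y : ((h \_ `[x, b]) y <= M)%R by rewrite patchE; case: ifP.
have prim y : (a <= y <= x)%R -> primitive a (h \_ `[x, b]) y = 0%R.
  move=> /andP[ay yx]; apply: EFin_inj; rewrite (EFin_primitive _ mh' h'0 h'M).
  rewrite /leb1 -integral_itv_bndo_bndc; last first.
    by apply/measurable_EFinP; exact: measurable_funTS.
  apply: integral0_eq => t /=; rewrite in_itv/= => /andP[_ ty].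
  by rewrite patchE mem_setE in_itv/= leNgt (lt_le_trans ty yx).
have c0 : (0 <= B / nutot)%R by rewrite divr_ge0// ltW.
have := @osc M _ mh' h'0 h'M a x (B / nutot)%R (lexx a) xb c0.
rewrite wLp_norm_patch// BE => H.
rewrite -/nutot (_ : B%:E = (B / nutot)%:E * nutot%:E); last first.
  by rewrite -EFinM divfK// gt_eqF.
rewrite muleA (EFinM C) (muleAC C%:E) lee_wpmul2r ?lee_fin ?(ltW nu0)//.
apply: H => y /prim ->.
by rewrite avg sub0r normrN ger0_norm.
Qed.

End hardy.

(** * Duality *)

Section duality.
Context {R : realType}.
Variables (D : set R) (p B g K : R) (V w : R -> R).
Hypothesis mD : measurable D.
Hypothesis Doo : leb1 D < +oo.
Hypothesis mV : measurable_fun D V.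
Hypothesis V0 : forall t, D t -> (0 <= V t)%R.
Hypothesis VB : forall t, D t -> (V t <= B)%R.
Hypothesis mw : measurable_fun D w.
Hypothesis w0 : forall t, D t -> (0 <= w t)%R.
Hypothesis g0 : (0 <= g)%R.
Hypothesis K0 : (0 <= K)%R.
(* In the applications [V] is [nu[a, t]] or [nu[t, b]], and [g] is the gauge norm
   of the indicator of the complementary interval. *)
Hypothesis weak_bound : forall (M : R) (h : R -> R), measurable_fun setT h ->
  (forall x, (0 <= h x)%R) -> (forall x, (h x <= M)%R) ->
  g%:E * \int[leb1]_(t in D) (V t * h t)%:E <=
  K%:E * wLp_norm leb1 D p w (EFin \o h).

Lemma integral_bounded_fin (u : R -> R) (N : R) : measurable_fun D u ->
  (forall t, D t -> (0 <= u t <= N)%R) ->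
  \int[leb1]_(t in D) (u t)%:E < +oo.
Proof.
move=> mu uN; apply: (@le_lt_trans _ _ (\int[leb1]_(t in D) (cst `|N|%:E t))).
  apply: ge0_integral_homo => t /uN /andP[u0 le]; rewrite lee_fin//.
  by rewrite (le_trans le)// ler_norm.
by rewrite integral_cst// lte_mul_pinfty.
Qed.

(** For [p = 1], testing with the indicator of the set where the pointwise bound
    fails shows that this set is negligible. *)
Lemma weak_bound1_ae : p = 1%R ->
  {ae leb1, forall t, D t -> (g * V t <= K * w t)%R}.
Proof.
move=> p1; pose E := D `&` [set t | (K * w t < g * V t)%R].
have mgV : measurable_fun D (fun t => g * V t)%R by exact: measurable_funM.
have mKw : measurable_fun D (fun t => K * w t)%R by exact: measurable_funM.
have mE : measurable E.
  have := measurable_fun_ltr mKw mgV mD (Y := [set true]) I.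
  by congr (measurable _); apply/seteqP; split => t [].
have ED : E `<=` D by move=> t [].
have mgVE := measurable_funS mD ED mgV; have mKwE := measurable_funS mD ED mKw.
have gV0 t : E t -> (0 <= g * V t)%R by move=> Et; rewrite mulr_ge0// V0//; exact: ED.
have Kw0 t : E t -> (0 <= K * w t)%R by move=> Et; rewrite mulr_ge0// w0//; exact: ED.
have indl (u : R -> R) : \int[leb1]_(t in D) (u t * (\1_E : R -> R) t)%:E =
    \int[leb1]_(t in E) (u t)%:E.
  rewrite [LHS]integral_mkcond [RHS]integral_mkcond; apply: eq_integral => t _.
  rewrite !patchE indicE; case: ifPn => tD; case: ifPn => tE; rewrite ?mulr1 ?mulr0//.
  by move: (mem_set (ED _ (set_mem tE))); rewrite (negbTE tD).
have le1 : \int[leb1]_(t in E) (g * V t)%:E <= \int[leb1]_(t in E) (K * w t)%:E.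
  have := @weak_bound 1%R \1_E (measurable_indic mE).
  rewrite indl /wLp_norm /wintegral p1 invr1 poweRe1; last first.
    by apply: integral_ge0 => t Dt; rewrite mule_ge0 ?poweR_ge0// lee_fin w0.
  have -> : \int[leb1]_(t in D) (`|(EFin \o \1_E) t| `^ 1 * (w t)%:E) =
      \int[leb1]_(t in E) (w t)%:E.
    rewrite -indl; apply: eq_integral => t _; rewrite poweRe1// /= muleC -EFinM.
    by rewrite ger0_norm.
  have mVE : measurable_fun E (fun t => (V t)%:E).
    by apply/measurable_EFinP; exact: measurable_funS mV.
  have mwE : measurable_fun E (fun t => (w t)%:E).
    by apply/measurable_EFinP; exact: measurable_funS mw.
  have VE0 t : E t -> 0 <= (V t)%:E by move=> Et; rewrite lee_fin V0//; exact: ED.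
  have wE0 t : E t -> 0 <= (w t)%:E by move=> Et; rewrite lee_fin w0//; exact: ED.
  have VK := ge0_integralZl leb1 mE mVE (k := g%:E) VE0 g0.
  have wK := ge0_integralZl leb1 mE mwE (k := K%:E) wE0 K0.
  rewrite -VK -wK.
  apply; first by move=> x; rewrite indicE.
  by move=> x; rewrite indicE; case: (x \in E) => //=.
have fin : \int[leb1]_(t in E) (K * w t)%:E \is a fin_num.
  rewrite ge0_fin_numE; last by apply: integral_ge0 => t Et; rewrite lee_fin Kw0.
  apply: (@le_lt_trans _ _ (\int[leb1]_(t in D) (g * V t)%:E)).
    apply: ge0_integral_homo_sub; first exact: ED.
    - by move=> t Et; rewrite lee_fin Kw0.
    - by move=> t Dt; rewrite lee_fin mulr_ge0// V0.
    - by move=> t [_ /= lt]; rewrite lee_fin ltW.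
  apply: (integral_bounded_fin (N := (g * B)%R)) => // t Dt.
  by rewrite mulr_ge0 ?V0//= ler_wpM2l// VB.
pose f t := (g * V t - K * w t)%R.
have f0 t : E t -> (0 <= f t)%R by move=> [_ /= lt]; rewrite subr_ge0 ltW.
have mf : measurable_fun E f by exact: measurable_funB.
have If : \int[leb1]_(t in E) (f t)%:E = 0.
  apply/le_anti/andP; split; last by apply: integral_ge0 => t Et; rewrite lee_fin f0.
  rewrite -(leeD2rE _ _ fin) add0e; apply: le_trans le1.
  rewrite -ge0_integralD//; last 2 first.
  - exact/measurable_EFinP.
  - exact/measurable_EFinP.
  by under eq_integral do rewrite -EFinD subrK.
have mfE : measurable_fun E (EFin \o f) by exact/measurable_EFinP.
have : \int[leb1]_(t in E) `|(EFin \o f) t| = 0.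
  rewrite -[RHS]If; apply: eq_integral => t /set_mem Et.
  by rewrite gee0_abs// lee_fin f0.
move=> /(ae_eq_integral_abs leb1 mE mfE).1.
apply: (@filterS _ _ (ae_filter_ringOfSetsType leb1)) => t H Dt.
rewrite leNgt; apply/negP => lt; have /H : E t by [].
by move=> /= [/eqP]; rewrite subr_eq0 => /eqP eq; rewrite eq ltxx in lt.
Qed.

(** For [p > 1], the extremal function of Hoelder's inequality,
    [V ^ (q - 1) * w ^ (1 - q)], is unbounded in general; with [w] replaced by
    [max w (1 / (n + 1))] it is bounded and still compares well with [w]. *)
Let q := (p / (p - 1))%R.
Let wn (n : nat) t := Num.max (w t) (n.+1%:R^-1)%R.
Let un (n : nat) t := (V t `^ q * (wn n t)^-1 `^ (q - 1))%R.

Lemma measurable_approx (n : nat) r : measurable_fun D (fun t => (wn n t)^-1 `^ r)%R.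
Proof.
apply: (measurableT_comp (measurable_powR r)).
have -> : (fun t => (wn n t)^-1)%R = (fun t => wn n t `^ (-1))%R.
  by apply/funext => t; rewrite powR_inv1// /wn le_max invr_ge0 ler0n orbT.
by apply: (measurableT_comp (measurable_powR (-1)%R)); apply: measurable_maxr.
Qed.

Lemma measurable_powV r : measurable_fun D (fun t => V t `^ r)%R.
Proof. exact: (measurableT_comp (measurable_powR r)). Qed.

Lemma weak_bound_approx (n : nat) : (1 < p)%R ->
  g%:E * (\int[leb1]_(t in D) (un n t)%:E) `^ q^-1 <= K%:E.
Proof.
move=> p1; have p0 : (0 < p)%R by rewrite (lt_trans _ p1).
have pm0 : (0 < p - 1)%R by rewrite subr_gt0.
have q0 : (0 < q)%R by rewrite divr_gt0.
have qm1 : (q - 1 = (p - 1)^-1)%R by rewrite /q; field; rewrite gt_eqF.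
have qm0 : (0 < q - 1)%R by rewrite qm1 invr_gt0.
have pq : (p * (q - 1) = q)%R by rewrite qm1.
have pq1 : (p^-1 + q^-1 = 1)%R by rewrite /q; field; rewrite !gt_eqF.
have wn0 t : (0 < wn n t)%R by rewrite /wn lt_max invr_gt0 ltr0Sn orbT.
have wn'0 t : (0 <= (wn n t)^-1)%R by rewrite invr_ge0 ltW.
pose h := (fun t => V t `^ (q - 1) * (wn n t)^-1 `^ (q - 1))%R.
have mh : measurable_fun D h.
  by apply: measurable_funM; [exact: measurable_powV|exact: measurable_approx].
have mun : measurable_fun D (un n).
  by apply: measurable_funM; [exact: measurable_powV|exact: measurable_approx].
have wnle t : ((wn n t)^-1 <= n.+1%:R)%R.
  by rewrite -[leRHS]invrK lef_pV2 ?posrE ?invr_gt0// /wn le_max lexx orbT.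
have B0 t : D t -> (0 <= B)%R by move=> Dt; rewrite (le_trans (V0 Dt))// VB.
have hle t : D t -> (h t <= B `^ (q - 1) * n.+1%:R `^ (q - 1))%R.
  move=> Dt; rewrite /h ler_pM ?powR_ge0//; apply: ge0_ler_powR;
    by rewrite ?(ltW qm0) ?nnegrE ?V0 ?(B0 t) ?VB// wn'0.
have unle t : D t -> (0 <= un n t <= B `^ q * n.+1%:R `^ (q - 1))%R.
  move=> Dt; rewrite /un mulr_ge0 ?powR_ge0//= ler_pM ?powR_ge0//; apply: ge0_ler_powR;
    by rewrite ?(ltW q0) ?(ltW qm0) ?nnegrE ?V0 ?(B0 t) ?VB// wn'0.
have hV t : D t -> (V t * h t = un n t)%R.
  by move=> Dt; rewrite /h /un mulrA mulr_powRB1// V0.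
have hw t : D t -> (h t `^ p * w t <= un n t)%R.
  move=> Dt; apply: (@le_trans _ _ (h t `^ p * wn n t)%R).
    by rewrite ler_wpM2l ?powR_ge0// /wn le_max lexx.
  have xq : ((wn n t)^-1 `^ q * wn n t = (wn n t)^-1 `^ (q - 1))%R.
    by rewrite -(mulr_powRB1 (wn'0 t) q0) mulrAC mulVf ?mul1r// gt_eqF.
  by rewrite /h powRM ?powR_ge0// -!powRrM (mulrC _ p) pq -mulrA xq.
have S0 : 0 <= \int[leb1]_(t in D) (un n t)%:E.
  by apply: integral_ge0 => t Dt; rewrite lee_fin; case/andP: (unle t Dt).
have := integral_bounded_fin mun unle.
have patchM t : ((h \_ D) t <= B `^ (q - 1) * n.+1%:R `^ (q - 1))%R.
  rewrite patchE; case: ifPn => [/set_mem/hle//|_].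
  by rewrite mulr_ge0 ?powR_ge0.
have mhD : measurable_fun setT (h \_ D) by apply/(measurable_restrictT _ _).1.
have h0 t : (0 <= (h \_ D) t)%R.
  by rewrite patchE; case: ifP => // _; rewrite mulr_ge0 ?powR_ge0.
have := weak_bound mhD h0 patchM.
have -> : \int[leb1]_(t in D) (V t * (h \_ D) t)%:E = \int[leb1]_(t in D) (un n t)%:E.
  by apply: eq_integral => t tD; rewrite patchE tD hV//; exact: set_mem.
have Nle : wLp_norm leb1 D p w (EFin \o (h \_ D)) <=
    (\int[leb1]_(t in D) (un n t)%:E) `^ p^-1.
  have i0 : 0 <= wintegral leb1 D w (fun t => `|(EFin \o (h \_ D)) t| `^ p).
    by apply: integral_ge0 => t Dt; rewrite mule_ge0 ?poweR_ge0// lee_fin w0.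
  rewrite /wLp_norm; apply: gt0_ler_poweR; rewrite ?invr_ge0 ?(ltW p0)// ?in_itv.
  - by apply/andP; split; [exact: i0|exact: leey].
  - by apply/andP; split; [exact: S0|exact: leey].
  apply: ge0_integral_homo => t Dt.
    by rewrite mule_ge0 ?poweR_ge0// lee_fin w0.
  by rewrite /= ger0_norm// patchE mem_set// -EFinM lee_fin hw.
move=> H Soo; have {H Nle} := le_trans H (lee_wpmul2l (K0 : 0 <= K%:E) Nle).
move: S0 Soo; case: (\int[leb1]_(t in D) (un n t)%:E) => [S| |]// S0 _.
rewrite !poweR_EFin -!EFinM !lee_fin in S0 * => le.
have [->|Sn0] := eqVneq S 0%R.
  by rewrite powR0 ?mulr0// invr_eq0 gt_eqF.
have Sgt : (0 < S)%R by rewrite lt_neqAle eq_sym Sn0.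
rewrite -(ler_pM2r (powR_gt0 p^-1 Sgt)) -mulrA -powRD; last by rewrite Sn0 implybT.
by rewrite addrC pq1 powRr1.
Qed.

(** The approximations increase to the integrand of the conclusion, including
    where [w] vanishes. *)
Lemma weak_boundp : (1 < p)%R ->
  g%:E * (\int[leb1]_(t in D)
    ((V t)%:E `^ q * (w t)%:E^-1 `^ (q - 1))) `^ q^-1 <= K%:E.
Proof.
move=> p1; have p0 : (0 < p)%R by rewrite (lt_trans _ p1).
have pm0 : (0 < p - 1)%R by rewrite subr_gt0.
have q0 : (0 < q)%R by rewrite divr_gt0.
have qm1 : (q - 1 = (p - 1)^-1)%R by rewrite /q; field; rewrite gt_eqF.
have qm0 : (0 < q - 1)%R by rewrite qm1 invr_gt0.
have [->|gn0] := eqVneq g 0%R; first by rewrite mul0e lee_fin.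
have ggt : (0 < g)%R by rewrite lt_neqAle eq_sym gn0.
have wn0 n t : (0 < wn n t)%R by rewrite /wn lt_max invr_gt0 ltr0Sn orbT.
have nd t : {homo (fun n => (un n t)%:E) : n m / (n <= m)%N >-> n <= m}.
  move=> n m nm; rewrite lee_fin ler_wpM2l ?powR_ge0//.
  apply: ge0_ler_powR; rewrite ?(ltW qm0) ?nnegrE ?invr_ge0 ?(ltW (wn0 _ _))//.
  rewrite lef_pV2 ?posrE// /wn ge_max le_max lexx/= le_max.
  by rewrite (lef_pV2 (x := m.+1%:R)) ?posrE// ler_nat ltnS nm orbT.
have limE t : limn (fun n => (un n t)%:E) = ereal_sup (range (fun n => (un n t)%:E)).
  exact: (cvg_lim (@ereal_hausdorff R) (ereal_nondecreasing_cvgn (nd t))).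
pose u t := (V t)%:E `^ q * (w t)%:E^-1 `^ (q - 1).
have ulim t : D t -> u t <= limn (fun n => (un n t)%:E).
  move=> Dt; rewrite limE /u.
  have usup n : (un n t)%:E <= ereal_sup (range (fun n => (un n t)%:E)).
    by apply: ereal_sup_ubound; exists n.
  have [wt0|wtn0] := eqVneq (w t) 0%R; last first.
    have wtgt : (0 < w t)%R by rewrite lt_neqAle eq_sym wtn0 w0.
    pose n := Num.trunc (w t)^-1%R.
    apply: le_trans (usup n); rewrite inver (negbTE wtn0) !poweR_EFin -EFinM lee_fin.
    rewrite /un /wn (max_idPl _)// -[leRHS]invrK lef_pV2 ?posrE ?invr_gt0//.
    exact/ltW/truncnS_gt.
  rewrite wt0 inver eqxx poweRyr ?(gt_eqF qm0)// poweR_EFin.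
  have [Vt0|Vtn0] := eqVneq (V t) 0%R.
    rewrite Vt0 powR0 ?(gt_eqF q0)// mul0e.
    by apply: le_trans (usup 0%N); rewrite lee_fin mulr_ge0 ?powR_ge0.
  have c0 : (0 < V t `^ q)%R by rewrite powR_gt0// lt_neqAle eq_sym Vtn0 V0.
  rewrite [leRHS]eq_infty ?leey// => r.
  pose y := ((`|r| / V t `^ q) `^ (q - 1)^-1)%R.
  apply: le_trans (usup (Num.trunc y)); rewrite lee_fin.
  apply: (le_trans (ler_norm r)); rewrite /un mulrC -ler_pdivrMr//.
  have -> : (`|r| / V t `^ q = y `^ (q - 1))%R.
    by rewrite /y -powRrM mulVf ?(gt_eqF qm0)// powRr1// divr_ge0// ltW.
  apply: ge0_ler_powR; rewrite ?(ltW qm0) ?nnegrE ?powR_ge0 ?invr_ge0 ?(ltW (wn0 _ _))//.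
  rewrite /wn wt0 (max_idPr _) ?invr_ge0// invrK.
  exact/ltW/truncnS_gt.
have u0 t : 0 <= u t by rewrite mule_ge0 ?poweR_ge0.
have un0 n t : D t -> 0 <= (un n t)%:E by move=> _; rewrite lee_fin mulr_ge0 ?powR_ge0.
have mun n : measurable_fun D (fun t => (un n t)%:E).
  apply/measurable_EFinP.
  by apply: measurable_funM; [exact: measurable_powV|exact: measurable_approx].
have Kg0 : (0 <= K / g)%R by rewrite divr_ge0.
have bound : \int[leb1]_(t in D) u t <= ((K / g) `^ q)%:E.
  apply: (@le_trans _ _ (\int[leb1]_(t in D) limn (fun n => (un n t)%:E))).
    exact: ge0_integral_homo.
  rewrite (monotone_convergence leb1 mD mun un0 (fun t _ => nd t)).
  apply: lime_le.
    apply: ereal_nondecreasing_is_cvgn => n m nm.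
    by apply: ge0_integral_homo; [exact: un0|move=> t _; exact: nd].
  apply: nearW => n; have S0 : 0 <= \int[leb1]_(t in D) (un n t)%:E.
    by apply: integral_ge0; exact: un0.
  have := weak_bound_approx n p1; rewrite muleC -lee_pdivlMr// -EFinM => le.
  rewrite -[leLHS]poweRe1// -(mulVf (lt0r_neq0 q0)) poweRrM -poweR_EFin.
  apply: gt0_ler_poweR le; rewrite ?(ltW q0)// in_itv.
    by apply/andP; split; [exact: poweR_ge0|exact: leey].
  by apply/andP; split; [exact: Kg0|exact: leey].
apply: (@le_trans _ _ (g%:E * (((K / g) `^ q)%:E `^ q^-1))).
  rewrite lee_wpmul2l//; apply: gt0_ler_poweR bound; rewrite ?invr_ge0 ?(ltW q0)// in_itv.
    by apply/andP; split; [apply: integral_ge0 => t _; exact: u0|exact: leey].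
  by apply/andP; split; [exact: (powR_ge0 (K / g) q)|exact: leey].
rewrite poweR_EFin -powRrM divff ?(gt_eqF q0)// powRr1// -EFinM lee_fin.
by rewrite mulrCA divff ?mulr1.
Qed.

End duality.

(** * Continuity of masses *)

Section mass_continuity.
Context {R : realType}.
Variables (a b : R) (mu : R -> R).
Hypothesis hmu : weight (T := measurableTypeR R) `[a, b] mu.

Lemma bounded_integral_bigcup (F : nat -> set R) (f : R -> \bar R) (M : \bar R) :
  {homo F : n m / (n <= m)%N >-> (n <= m)%O} -> (forall n, measurable (F n)) ->
  (forall n, measurable_fun (F n) f) -> (forall n x, F n x -> 0 <= f x) ->
  (forall n, \int[leb1]_(x in F n) f x <= M) ->
  \int[leb1]_(x in \bigcup_n F n) f x <= M.
Proof.
move=> ndF mF mf f0 FM.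
have H := ge0_nondecreasing_set_cvg_integral (mu := leb1) ndF mF mf f0.
rewrite -(cvg_lim (@ereal_hausdorff R) H).
apply: lime_le; last exact: nearW.
by apply/cvg_ex; eexists; exact: H.
Qed.

(** The mass of an interval is controlled by the masses of the intervals with a
    rational endpoint that exhaust it up to one point. *)
Lemma imass_limit_left (t : R) (M : \bar R) : (a <= t < b)%R ->
  (forall r : rat, (t < ratr r < b)%R -> imass mu (ratr r) b <= M) ->
  imass mu t b <= M.
Proof.
move=> /andP[at_ tb] ratM.
have sM (s : R) : (t < s <= b)%R -> imass mu s b <= M.
  move=> /andP[ts sb]; have [r] := rat_in_itvoo ts; rewrite in_itv/= => /andP[tr rs].
  apply: (le_trans _ (ratM r _)); last by rewrite tr (lt_le_trans rs).
  by apply: (imass_le hmu); rewrite ?(ltW rs)// (le_trans at_)// ltW.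
pose s n := (t + (b - t) / n.+1%:R)%R.
have st n : (t < s n)%R by rewrite ltrDl divr_gt0// subr_gt0.
have sb n : (s n <= b)%R.
  rewrite -lerBrDl ler_pdivrMr// ler_peMr ?subr_ge0 ?(ltW tb)//.
  by rewrite ler1n.
have sub n : `[s n, b] `<=` `[a, b].
  by apply: subitv => //; rewrite (le_trans at_)// ltW.
have mtb : measurable_fun `]t, b] mu.
  by apply: measurable_funS (measurable_weight hmu at_ (lexx b)) => // x /=;
    rewrite !in_itv/= => /andP[/ltW -> ->].
have -> : imass mu t b = \int[leb1]_(x in \bigcup_n `[s n, b]%classic) (mu x)%:E.
  have -> : \bigcup_n `[s n, b]%classic = `]t, b]%classic.
    apply/seteqP; split => x /=.
      by move=> [n _ /=]; rewrite !in_itv/= => /andP[sx ->]; rewrite (lt_le_trans (st n)).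
    rewrite in_itv/= => /andP[tx xb]; exists (Num.trunc ((b - t) / (x - t))) => //.
    rewrite /= in_itv/= xb andbT -lerBrDl ler_pdivrMr// mulrC -ler_pdivrMr ?subr_gt0//.
    exact/ltW/truncnS_gt.
  rewrite /imass /wmass /leb1 integral_itv_obnd_cbnd//; exact/measurable_EFinP.
apply: bounded_integral_bigcup => //.
- move=> n m nm; apply/subsetPset => x /=; rewrite !in_itv/= => /andP[sx ->]; rewrite andbT.
  apply: le_trans sx; rewrite lerD2l ler_wpM2l ?subr_ge0 ?(ltW tb)//.
  by rewrite lef_pV2 ?posrE// ler_nat ltnS.
- move=> n; apply/measurable_EFinP; apply: (measurable_weight hmu) => //.
  by rewrite (le_trans at_)// ltW.
- by move=> n x /sub xab; rewrite lee_fin; exact: hmu.2.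
- by move=> n; apply: sM; rewrite st sb.
Qed.

Lemma imass_limit_right (t : R) (M : \bar R) : (a < t <= b)%R ->
  (forall r : rat, (a < ratr r < t)%R -> imass mu a (ratr r) <= M) ->
  imass mu a t <= M.
Proof.
move=> /andP[at_ tb] ratM.
have sM (s : R) : (a <= s < t)%R -> imass mu a s <= M.
  move=> /andP[as_ st]; have [r] := rat_in_itvoo st; rewrite in_itv/= => /andP[sr rt].
  apply: (le_trans _ (ratM r _)); last by rewrite rt (le_lt_trans as_).
  by apply: (imass_le hmu); rewrite ?(ltW sr)// (le_trans (ltW rt)).
pose s n := (t - (t - a) / n.+1%:R)%R.
have st n : (s n < t)%R by rewrite ltrBlDr ltrDl divr_gt0// subr_gt0.
have as_ n : (a <= s n)%R.
  rewrite lerBrDr -lerBrDl ler_pdivrMr// ler_peMr ?subr_ge0 ?(ltW at_)//.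
  by rewrite ler1n.
have sub n : `[a, s n] `<=` `[a, b].
  by apply: subitv => //; rewrite (le_trans _ tb)// ltW.
have mat : measurable_fun `[a, t[ mu.
  by apply: measurable_funS (measurable_weight hmu (lexx a) tb) => // x /=;
    rewrite !in_itv/= => /andP[-> /ltW ->].
have -> : imass mu a t = \int[leb1]_(x in \bigcup_n `[a, s n]%classic) (mu x)%:E.
  have -> : \bigcup_n `[a, s n]%classic = `[a, t[%classic.
    apply/seteqP; split => x /=.
      by move=> [n _ /=]; rewrite !in_itv/= => /andP[-> xs]; rewrite (le_lt_trans xs).
    rewrite in_itv/= => /andP[ax xt]; exists (Num.trunc ((t - a) / (t - x))) => //.
    rewrite /= in_itv/= ax/= lerBrDr -lerBrDl ler_pdivrMr// mulrC -ler_pdivrMr ?subr_gt0//.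
    exact/ltW/truncnS_gt.
  rewrite /imass /wmass /leb1 integral_itv_bndo_bndc//; exact/measurable_EFinP.
apply: bounded_integral_bigcup => //.
- move=> n m nm; apply/subsetPset => x /=; rewrite !in_itv/= => /andP[-> xs] /=.
  apply: (le_trans xs); rewrite lerD2l lerN2 ler_wpM2l ?subr_ge0 ?(ltW at_)//.
  by rewrite lef_pV2 ?posrE// ler_nat ltnS.
- move=> n; apply/measurable_EFinP; apply: (measurable_weight hmu) => //.
  by rewrite (le_trans _ tb)// ltW.
- by move=> n x /sub xab; rewrite lee_fin; exact: hmu.2.
- by move=> n; apply: sM; rewrite st as_.
Qed.

End mass_continuity.

(** * Finiteness of the constants *)

Section constants.
Context {R : realType}.
Variables (a b p C : R) (Phi mu nu w : R -> R).
Hypothesis hmu : weight (T := measurableTypeR R) `[a, b] mu.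
Hypothesis hnu : weight (T := measurableTypeR R) `[a, b] nu.
Hypothesis hw : weight (T := measurableTypeR R) `[a, b] w.
Hypothesis muP : 0 < imass mu a b < +oo.
Hypothesis nuP : 0 < imass nu a b < +oo.
Hypothesis p1 : (1 <= p)%R.
Hypothesis C0 : (0 < C)%R.
Hypotheses (hPhi : young_function Phi) (hPhi_inv : young_invertible Phi).
Hypothesis osc : oscillation_bound a b p Phi mu nu w C.

Let nutot := fine (imass nu a b).
Let K := (C * nutot)%R.

Let p0 : (0 < p)%R. Proof. exact: lt_le_trans p1. Qed.

Let muoo : imass mu a b < +oo. Proof. by case/andP: muP. Qed.

Let nuoo : imass nu a b < +oo. Proof. by case/andP: nuP. Qed.

Let nuE : imass nu a b = nutot%:E.
Proof. by rewrite /nutot fineK// (imass_fin hnu nuoo). Qed.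

Let nu0 : (0 < nutot)%R.
Proof. by rewrite -lte_fin -nuE; case/andP: nuP. Qed.

Let K0 : (0 <= K)%R. Proof. by rewrite mulr_ge0// ltW. Qed.

Let Vl t := fine (imass nu a t).
Let Vr t := fine (imass nu t b).

Lemma imass_lE t : (a <= t <= b)%R -> imass nu a t = (Vl t)%:E.
Proof. by move=> /andP[at_ tb]; rewrite /Vl fineK// (imass_fin hnu nuoo). Qed.

Lemma imass_rE t : (a <= t <= b)%R -> imass nu t b = (Vr t)%:E.
Proof. by move=> /andP[at_ tb]; rewrite /Vr fineK// (imass_fin hnu nuoo). Qed.

Lemma imass_l_bound t : (a <= t <= b)%R -> (0 <= Vl t <= nutot)%R.
Proof.
move=> tab; have [at_ tb] := andP tab; rewrite -!lee_fin -imass_lE// -nuE.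
by rewrite (imass_ge0 hnu)//= (imass_le hnu).
Qed.

Lemma imass_r_bound t : (a <= t <= b)%R -> (0 <= Vr t <= nutot)%R.
Proof.
move=> tab; have [at_ tb] := andP tab; rewrite -!lee_fin -imass_rE// -nuE.
by rewrite (imass_ge0 hnu)//= (imass_le hnu).
Qed.

Lemma itv_leb1_lty (s t : R) : leb1 `[s, t]%classic < +oo.
Proof.
rewrite /leb1/= (@lebesgue_measure_itv R `[s, t])/=.
by case: ifP => // _; rewrite -EFinB ltry.
Qed.

Lemma gauge_coefE (s t : R) : (a <= s)%R -> (t <= b)%R ->
  exists2 g, (0 <= g)%R & (young_inv Phi (imass mu s t)^-1)^-1 = g%:E.
Proof.
move=> sa tb; apply: gauge_coef_fin => //; first exact: (imass_ge0 hmu).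
by rewrite -ge0_fin_numE ?(imass_ge0 hmu)// (imass_fin hmu).
Qed.

Lemma Ktildep_lty : (1 < p)%R -> Ktildep p a b Phi mu nu w < +oo.
Proof.
move=> p1'; rewrite /Ktildep; set q := (p / (p - 1))%R.
apply: (@le_lt_trans _ _ (nutot^-1%:E * (K%:E + K%:E))); last first.
  by rewrite -EFinD -EFinM ltry.
rewrite nuE inver (gt_eqF nu0) lee_wpmul2l ?lee_fin ?invr_ge0 ?(ltW nu0)//.
apply: leeD; apply: ge_ereal_sup => _ [x + <-]; rewrite /= in_itv/= => /andP[ax xb].
- have [g g0 gE] := gauge_coefE (ltW ax) (lexx b); rewrite gE.
  have sub : `[a, x] `<=` `[a, b] by apply: subitv; rewrite ?(ltW xb).
  rewrite (_ : \int[leb1]_(t in `[a, x]) _ = \int[leb1]_(t in `[a, x])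
      ((Vl t)%:E `^ q * (w t)%:E^-1 `^ (q - 1))); last first.
    by apply: eq_integral => t /set_mem /sub; rewrite /= in_itv/= => tab; rewrite imass_lE.
  apply: (weak_boundp (B := nutot)) => //.
  + exact: itv_leb1_lty.
  + exact: measurable_funS (measurable_imassl hnu nuoo).
  + by move=> t /sub; rewrite /= in_itv/= => /imass_l_bound /andP[].
  + by move=> t /sub; rewrite /= in_itv/= => /imass_l_bound /andP[].
  + exact: (measurable_weight hw (lexx a) (ltW xb)).
  + by move=> t /sub; exact: hw.2.
  + move=> M h mh h0 hM; rewrite -gE.
    by apply: (hardy_left p0 hnu nuP osc) => //; rewrite (ltW ax) (ltW xb).
- have [g g0 gE] := gauge_coefE (lexx a) (ltW xb); rewrite gE.
  have sub : `[x, b] `<=` `[a, b] by apply: subitv; rewrite ?(ltW ax).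
  rewrite (_ : \int[leb1]_(t in `[x, b]) _ = \int[leb1]_(t in `[x, b])
      ((Vr t)%:E `^ q * (w t)%:E^-1 `^ (q - 1))); last first.
    by apply: eq_integral => t /set_mem /sub; rewrite /= in_itv/= => tab; rewrite imass_rE.
  apply: (weak_boundp (B := nutot)) => //.
  + exact: itv_leb1_lty.
  + exact: measurable_funS (measurable_imassr hnu nuoo).
  + by move=> t /sub; rewrite /= in_itv/= => /imass_r_bound /andP[].
  + by move=> t /sub; rewrite /= in_itv/= => /imass_r_bound /andP[].
  + exact: (measurable_weight hw (ltW ax) (lexx b)).
  + by move=> t /sub; exact: hw.2.
  + move=> M h mh h0 hM; rewrite -gE.
    by apply: (hardy_right p0 hnu nuP osc) => //; rewrite (ltW ax) (ltW xb).
Qed.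

(** Almost every [t] is controlled simultaneously for all rational cut points
    [r], which is the form in which the bound survives the passage [r -> t]. *)
Lemma weak_bound1_left : p = 1%R -> {ae leb1, forall t, forall r : rat,
  (a < t)%R -> (t < ratr r < b)%R ->
  (young_inv Phi (imass mu (ratr r) b)^-1)^-1 * (Vl t)%:E <= (K * w t)%:E}.
Proof.
move=> p1'; suff : {ae leb1, forall t, forall n (r : rat), unpickle n = Some r ->
    (a < t)%R -> (t < ratr r < b)%R ->
    (young_inv Phi (imass mu (ratr r) b)^-1)^-1 * (Vl t)%:E <= (K * w t)%:E}.
  apply: (@filterS _ _ (ae_filter_ringOfSetsType leb1)) => t H r.
  exact: (H (pickle r) r (pickleK r)).
apply: ae_foralln => n; case: (unpickle n) => [r|]; last exact: aeW.
have [/andP[ar rb]|out] := boolP ((a < ratr r) && (ratr r < b))%R; last first.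
  apply: aeW => t _ [<-] at_ /andP[tr rb].
  by move: out; rewrite rb (lt_trans at_ tr).
have sub : `[a, ratr r] `<=` `[a, b] by apply: subitv; rewrite ?(ltW rb).
have [g g0 gE] := gauge_coefE (ltW ar) (lexx b).
have wb : {ae leb1, forall t, `[a, ratr r]%classic t -> (g * Vl t <= K * w t)%R}.
  apply: (weak_bound1_ae (p := p) (B := nutot)) => //.
  + exact: itv_leb1_lty.
  + exact: measurable_funS (measurable_imassl hnu nuoo).
  + by move=> t /sub; rewrite /= in_itv/= => /imass_l_bound /andP[].
  + by move=> t /sub; rewrite /= in_itv/= => /imass_l_bound /andP[].
  + exact: (measurable_weight hw (lexx a) (ltW rb)).
  + by move=> t /sub; exact: hw.2.
  + move=> M h mh h0 hM; rewrite -gE.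
    by apply: (hardy_left p0 hnu nuP osc) => //; rewrite (ltW ar) (ltW rb).
apply: (@filterS _ _ (ae_filter_ringOfSetsType leb1) _ _ _ wb) => t H _ [<-] at_ /andP[tr _].
by rewrite gE -EFinM lee_fin H//= in_itv/= (ltW at_) ltW.
Qed.

Lemma weak_bound1_right : p = 1%R -> {ae leb1, forall t, forall r : rat,
  (t < b)%R -> (a < ratr r < t)%R ->
  (young_inv Phi (imass mu a (ratr r))^-1)^-1 * (Vr t)%:E <= (K * w t)%:E}.
Proof.
move=> p1'; suff : {ae leb1, forall t, forall n (r : rat), unpickle n = Some r ->
    (t < b)%R -> (a < ratr r < t)%R ->
    (young_inv Phi (imass mu a (ratr r))^-1)^-1 * (Vr t)%:E <= (K * w t)%:E}.
  apply: (@filterS _ _ (ae_filter_ringOfSetsType leb1)) => t H r.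
  exact: (H (pickle r) r (pickleK r)).
apply: ae_foralln => n; case: (unpickle n) => [r|]; last exact: aeW.
have [/andP[ar rb]|out] := boolP ((a < ratr r) && (ratr r < b))%R; last first.
  apply: aeW => t _ [<-] tb /andP[ar rt].
  by move: out; rewrite ar (lt_trans rt tb).
have sub : `[ratr r, b] `<=` `[a, b] by apply: subitv; rewrite ?(ltW ar).
have [g g0 gE] := gauge_coefE (lexx a) (ltW rb).
have wb : {ae leb1, forall t, `[ratr r, b]%classic t -> (g * Vr t <= K * w t)%R}.
  apply: (weak_bound1_ae (p := p) (B := nutot)) => //.
  + exact: itv_leb1_lty.
  + exact: measurable_funS (measurable_imassr hnu nuoo).
  + by move=> t /sub; rewrite /= in_itv/= => /imass_r_bound /andP[].
  + by move=> t /sub; rewrite /= in_itv/= => /imass_r_bound /andP[].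
  + exact: (measurable_weight hw (ltW ar) (lexx b)).
  + by move=> t /sub; exact: hw.2.
  + move=> M h mh h0 hM; rewrite -gE.
    by apply: (hardy_right p0 hnu nuP osc) => //; rewrite (ltW ar) (ltW rb).
apply: (@filterS _ _ (ae_filter_ringOfSetsType leb1) _ _ _ wb) => t H _ [<-] tb /andP[_ rt].
by rewrite gE -EFinM lee_fin H//= in_itv/= (ltW tb) ltW.
Qed.

(** Convexity of [Phi] at the midpoint bounds the gauge norm of a difference by
    twice a common admissible scale [k] of its two terms. *)
Lemma gauge_norm_two_steps (x k : R) : (a < x < b)%R -> (0 < k)%R ->
  (Phi (Vl x / k))%:E * imass mu x b <= 1 ->
  (Phi (Vr x / k))%:E * imass mu a x <= 1 ->
  gauge_norm leb1 `[a, b] Phi mu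
    (fun y => imass nu a x * (\1_(`[x, b] : set R) y)%:E
            - imass nu x b * (\1_(`[a, x] : set R) y)%:E) <= (2 * k)%:E.
Proof.
move=> /andP[ax xb] k0 adm1 adm2.
have xab : (a <= x <= b)%R by rewrite !ltW.
have k20 : (0 < 2 * k)%R by rewrite mulr_gt0.
apply: ge_ereal_inf; exists (2 * k)%:E => //; exists (2 * k)%R => //; split => //.
rewrite imass_lE// imass_rE//.
pose c1 := Phi (Vl x / k); pose c2 := Phi (Vr x / k).
have c10 : (0 <= c1)%R by exact: (young_ge0 hPhi).
have c20 : (0 <= c2)%R by exact: (young_ge0 hPhi).
have half (c : R) (A : set R) : (0 <= c)%R -> measurable A -> A `<=` `[a, b] ->
    \int[leb1]_(y in `[a, b]) (2^-1 * c * (\1_A : R -> R) y * mu y)%:E =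
    2^-1%:E * (c%:E * \int[leb1]_(y in A) (mu y)%:E).
  move=> c0 mA Aab; rewrite muleA -EFinM -ge0_integralZl//; last 3 first.
  - by apply/measurable_EFinP; exact: measurable_funS hmu.1.
  - by move=> y /Aab yab; rewrite lee_fin; exact: hmu.2.
  - by rewrite lee_fin mulr_ge0// invr_ge0.
  rewrite [LHS]integral_mkcond [RHS]integral_mkcond; apply: eq_integral => y _.
  rewrite !patchE indicE; case: ifPn => yab; case: ifPn => yA; rewrite ?mulr1 ?mulr0 ?mul0r//.
  by move: (mem_set (Aab _ (set_mem yA))); rewrite (negbTE yab).
have sub1 : `[x, b] `<=` `[a, b] by apply: subitv => //; exact: ltW.
have sub2 : `[a, x] `<=` `[a, b] by apply: subitv => //; exact: ltW.
have mhalf (c : R) (A : set R) : measurable A ->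
    measurable_fun `[a, b] (fun y => (2^-1 * c * (\1_A : R -> R) y * mu y)%:E).
  move=> mA; apply/measurable_EFinP/measurable_funM; last exact: hmu.1.
  by apply: measurable_funM => //; exact: measurable_indic.
have half0 (c : R) (A : set R) y : (0 <= c)%R -> `[a, b]%classic y ->
    0 <= (2^-1 * c * (\1_A : R -> R) y * mu y)%:E.
  move=> c0 yab; rewrite lee_fin mulr_ge0//; last exact: hmu.2.
  by rewrite mulr_ge0 ?mulr_ge0 ?invr_ge0// indicE.
have FE y : ((Vl x)%:E * (\1_(`[x, b] : set R) y)%:E -
    (Vr x)%:E * (\1_(`[a, x] : set R) y)%:E) / (2 * k)%:E =
    ((Vl x * (\1_(`[x, b]%classic) : R -> R) y -
      Vr x * (\1_(`[a, x]%classic) : R -> R) y) / (2 * k))%:E.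
  by rewrite inver gt_eqF.
apply: (@le_trans _ _ (\int[leb1]_(y in `[a, b])
    ((2^-1 * c1 * (\1_(`[x, b]%classic) : R -> R) y * mu y)%:E +
     (2^-1 * c2 * (\1_(`[a, x]%classic) : R -> R) y * mu y)%:E))).
  apply: ge0_integral_homo => y yab.
    by rewrite FE mule_ge0 ?lee_fin ?(young_ge0 hPhi)//; exact: hmu.2.
  rewrite FE /= -EFinM -EFinD lee_fin -mulrDl.
  rewrite ler_wpM2r ?hmu.2//.
  set e1 := (\1_(`[x, b]%classic) : R -> R) y; set e2 := (\1_(`[a, x]%classic) : R -> R) y.
  have -> : ((Vl x * e1 - Vr x * e2) / (2 * k) =
      2^-1 * (Vl x * e1 / k) + (1 - 2^-1) * - (Vr x * e2 / k))%R.
    by field; rewrite gt_eqF.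
  have h2 : (0 <= (2^-1 : R) <= 1)%R by rewrite invr_ge0 ler0n/= invf_le1// ler1n.
  apply: (le_trans (young_conv hPhi _ _ h2)); rewrite (young_even hPhi).
  have -> : (1 - 2^-1 = 2^-1 :> R)%R by field.
  have l1 : (Phi (Vl x * e1 / k) <= c1 * e1)%R.
    by rewrite /e1 indicE; case: (_ \in _); rewrite ?mulr1// !mulr0 mul0r (young0 hPhi).
  have l2 : (Phi (Vr x * e2 / k) <= c2 * e2)%R.
    by rewrite /e2 indicE; case: (_ \in _); rewrite ?mulr1// !mulr0 mul0r (young0 hPhi).
  by rewrite -(mulrA _ c1) -(mulrA _ c2) lerD// ler_wpM2l// invr_ge0.
rewrite ge0_integralD//; [|by move=> y; exact: half0|exact: mhalf|by move=> y; exact: half0|exact: mhalf].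
rewrite !half//.
apply: (@le_trans _ _ (2^-1%:E * 1 + 2^-1%:E * 1)).
  by apply: leeD; rewrite lee_wpmul2l// lee_fin invr_ge0.
rewrite !mule1 -EFinD lee_fin.
by have -> : (2^-1 + 2^-1 = 1 :> R)%R by field.
Qed.

Lemma Ktilde1_lty : p = 1%R -> Ktilde1 a b Phi mu nu w < +oo.
Proof.
move=> p1'; rewrite /Ktilde1.
apply: (@le_lt_trans _ _ (nutot^-1%:E * (2 * K)%:E)); last by rewrite -EFinM ltry.
rewrite nuE inver (gt_eqF nu0) lee_wpmul2l ?lee_fin ?invr_ge0 ?(ltW nu0)//.
apply/ess_supP.
have := weak_bound1_right p1'; have := weak_bound1_left p1'.
apply: (@filterS2 _ _ (ae_filter_ringOfSetsType leb1)) => x Hl Hr.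
rewrite patchE; case: ifPn => [/set_mem/=|_]; last by rewrite lee_fin mulr_ge0.
rewrite in_itv/= => /andP[ax xb].
have xab : (a <= x <= b)%R by rewrite !ltW.
have wx0 : (0 <= w x)%R by apply: hw.2; rewrite /= in_itv.
have [/andP[Vl0 _] /andP[Vr0 _]] := (imass_l_bound xab, imass_r_bound xab).
set G := gauge_norm _ _ _ _ _.
have G0 : 0 <= G by exact: gauge_norm_ge0.
have Gle : G <= (2 * (K * w x))%:E.
  apply/lee_addgt0Pr => e e0; pose k := (K * w x + e / 2)%R.
  have e20 : (0 < e / 2)%R by rewrite divr_gt0.
  have Kw0 : (0 <= K * w x)%R by rewrite mulr_ge0.
  have k0 : (0 < k)%R by exact: ltr_wpDl.
  have Kk : (K * w x <= k)%R by rewrite lerDl ltW.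
  have -> : (2 * (K * w x))%:E + e%:E = (2 * k)%:E by rewrite -EFinD /k; congr EFin; field.
  have cut (c : R) (W : \bar R) : (0 <= c)%R -> (c%:E * W <= 1) = (c == 0%R) || (W <= c^-1%:E).
    move=> c0; have [->|cn0] := eqVneq c 0%R; first by rewrite mul0e lee01.
    by rewrite -[in RHS](mul1e c^-1%:E) lee_pdivlMr 1?muleC// lt_neqAle eq_sym cn0.
  apply: gauge_norm_two_steps => //; first by rewrite ax.
  - rewrite cut ?(young_ge0 hPhi)//; case: eqP => //= /eqP cn0.
    apply: (imass_limit_left hmu); first by rewrite (ltW ax).
    move=> r /andP[xr rb]; have ar := lt_trans ax xr.
    have := Hl r ax; rewrite xr rb => /(_ isT) H.
    suff : (Phi (Vl x / k))%:E * imass mu (ratr r) b <= 1.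
      by rewrite cut ?(young_ge0 hPhi)// (negbTE cn0).
    apply: (gauge_coef_admissible hPhi hPhi_inv) => //.
    + exact: (imass_ge0 hmu (ltW ar)).
    + by rewrite -ge0_fin_numE ?(imass_ge0 hmu (ltW ar))// (imass_fin hmu muoo (ltW ar)).
    + by apply: (le_trans H); rewrite lee_fin.
  - rewrite cut ?(young_ge0 hPhi)//; case: eqP => //= /eqP cn0.
    apply: (imass_limit_right hmu); first by rewrite ax (ltW xb).
    move=> r /andP[ar rx]; have rb := lt_trans rx xb.
    have := Hr r xb; rewrite ar rx => /(_ isT) H.
    suff : (Phi (Vr x / k))%:E * imass mu a (ratr r) <= 1.
      by rewrite cut ?(young_ge0 hPhi)// (negbTE cn0).
    apply: (gauge_coef_admissible hPhi hPhi_inv) => //.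
    + exact: (imass_ge0 hmu (lexx a) (ltW rb)).
    + by rewrite -ge0_fin_numE ?(imass_ge0 hmu (lexx a) (ltW rb))// (imass_fin hmu muoo (lexx a) (ltW rb)).
    + by apply: (le_trans H); rewrite lee_fin.
(* where [w] vanishes the gauge norm does too, and [+oo * 0 = 0] *)
have [w0|wn0] := eqVneq (w x) 0%R.
  have -> : G = 0 by apply/le_anti; rewrite G0 andbT; move: Gle; rewrite w0 !mulr0.
  by rewrite mule0 lee_fin mulr_ge0.
have wgt : (0 < w x)%R by rewrite lt_neqAle eq_sym wn0.
rewrite inver (negbTE wn0) muleC lee_pdivrMr//.
by rewrite -EFinM -mulrA.
Qed.

Lemma Ktilde_lty : Ktilde p a b Phi mu nu w < +oo.
Proof.
rewrite /Ktilde; case: eqP => [p1'|/eqP pn1]; first exact: Ktilde1_lty.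
by apply: Ktildep_lty; rewrite lt_neqAle eq_sym pn1.
Qed.

End constants.

(** * Masses of the factors of a product weight *)

Lemma mule_pos_lty {R : realType} (x y : \bar R) : 0 <= x -> 0 <= y ->
  0 < x * y -> x * y < +oo -> 0 < x < +oo /\ 0 < y < +oo.
Proof.
move=> x0 y0 xy0 xyoo.
have xgt : 0 < x.
  by rewrite lt_neqAle x0 andbT; apply/eqP => xE; rewrite -xE mul0e ltxx in xy0.
have ygt : 0 < y.
  by rewrite lt_neqAle y0 andbT; apply/eqP => yE; rewrite -yE mule0 ltxx in xy0.
rewrite xgt ygt !ltey; split; apply/eqP => E; move: xyoo; rewrite E.
  by rewrite gt0_mulye ?ltxx.
by rewrite gt0_muley ?ltxx.
Qed.

Lemma prod_weight_masses {R : realType} (a b c d : R) (u v : R -> R) :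
  weight (T := measurableTypeR R) `[a, b] u ->
  weight (T := measurableTypeR R) `[c, d] v ->
  leb2.-integrable (`[a, b] `*` `[c, d]) (EFin \o prod_weight u v) ->
  0 < wmass leb2 (`[a, b] `*` `[c, d]) (prod_weight u v) ->
  0 < imass u a b < +oo /\ 0 < imass v c d < +oo.
Proof.
move=> hu hv hL1 gt0.
have E := wmass_prod_weight (measurable_itv `[a, b]) (measurable_itv `[c, d])
  hu.1 hv.1 hu.2 hv.2.
apply: mule_pos_lty; [exact: (imass_ge0 hu)|exact: (imass_ge0 hv)| |].
  by rewrite -[X in 0 < X]E.
rewrite -[X in X < _]E /wmass.
apply: (integrable_lty _ hL1).
by apply: measurableX; exact: measurable_itv.
Qed.

Theorem theorem1p3 (R : realType) (a b c d : R)
    (mu1 mu2 nu1 nu2 w1 w2 : R -> R) (p1 p2 s1 : R) (Phi : R -> R)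
    (I := `[a, b]%classic) (J := `[c, d]%classic)
    (hab : (a < b)%R) (hcd : (c < d)%R)
    (hmu1 : weight (T := measurableTypeR R) I mu1)
    (hmu2 : weight (T := measurableTypeR R) J mu2)
    (hnu1 : weight (T := measurableTypeR R) I nu1)
    (hnu2 : weight (T := measurableTypeR R) J nu2)
    (hw1 : weight (T := measurableTypeR R) I w1)
    (hw2 : weight (T := measurableTypeR R) J w2)
    (hmuL1 : leb2.-integrable (I `*` J) (EFin \o prod_weight mu1 mu2))
    (hnuL1 : leb2.-integrable (I `*` J) (EFin \o prod_weight nu1 nu2))
    (hmu_gt0 : 0 < wmass leb2 (I `*` J) (prod_weight mu1 mu2))
    (hnu_gt0 : 0 < wmass leb2 (I `*` J) (prod_weight nu1 nu2))
    (hp1 : (1 <= p1)%R) (hp2 : (1 <= p2)%R) (hs1 : (1 <= s1)%R)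
    (hPhi : young_function Phi) (hPhi_inv : young_invertible Phi) :
  (exists C1 C2 : R, [/\ (0 < C1)%R, (0 < C2)%R &
    forall f : R * R -> R, [lipschitz f x | x in I `*` J] ->
      gauge_norm leb2 (I `*` J) Phi (prod_weight mu1 mu2)
        (fun x => (f x - waverage leb2 (I `*` J) (prod_weight nu1 nu2) f)%:E)
      <= C1%:E * norm_Lp_gauge I J p1 Phi w1 mu2 (partial1 f)
       + C2%:E * (2%:E * (young_inv Phi (imass mu1 a b)^-1)^-1
                  / imass nu1 a b `^ s1^-1)
         * norm_hat I J s1 p2 nu1 w2 (partial2 f)]) ->
  Ktilde p1 a b Phi mu1 nu1 w1 < +oo /\ Ktilde p2 c d Phi mu2 nu2 w2 < +oo.
Proof.
move=> [C1 [C2 [C10 C20 poincare]]].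
have [mu1P mu2P] := prod_weight_masses hmu1 hmu2 hmuL1 hmu_gt0.
have [nu1P nu2P] := prod_weight_masses hnu1 hnu2 hnuL1 hnu_gt0.
split.
- have [C C0 osc] := oscillation_bound_fst hmu1 hmu2 hnu1 hnu2 hw1 mu1P mu2P
    nu1P nu2P hp1 hp2 hs1 hPhi hPhi_inv C10 poincare.
  exact: (Ktilde_lty hmu1 hnu1 hw1 mu1P nu1P hp1 C0 hPhi hPhi_inv osc).
- have [C C0 osc] := oscillation_bound_snd hmu1 hmu2 hnu1 hnu2 hw2 mu1P mu2P
    nu1P nu2P hp1 hp2 hs1 hPhi hPhi_inv C20 poincare.
  exact: (Ktilde_lty hmu2 hnu2 hw2 mu2P nu2P hp2 C0 hPhi hPhi_inv osc).
Qed.
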